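(* Let $\mathcal{C}$ be a unitary modular tensor category with modular data $\{n,\Delta,N,S,T\}$. Choose one representative $a,b,c,\dots$ in each unitary isomorphism class of irreducible objects in $\Delta$. Then there is a choice, for every triple $(a,b,c)$ of representatives, of an orthonormal basis of isometries $t^e_{c,ab}$, $e=1,\dots,N^k_{i,j}$, of $\mathrm{Hom}_{\mathcal{C}}(c,a\times b)$, where $i,j,k$ label the classes of $a,b,c$ in $\Delta$ respectively, such that the following holds. If $a\neq b$, then $$R_{c,ab}=R_{c,ba}=\Big(\frac{\omega_k}{\omega_i\omega_j}\Big)^{1/2}\mathbf{1}_{N^k_{i,j}},\qquad R^{\mathrm{op}}_{c,ab}=R^{\mathrm{op}}_{c,ba}=\Big(\frac{\omega_i\omega_j}{\omega_k}\Big)^{1/2}\mathbf{1}_{N^k_{i,j}},$$ where $\mathbf{1}_{N^k_{i,j}}$ is the identity matrix of size $N^k_{i,j}$, and $R_{c,ab}$ and $R^{\mathrm{op}}_{c,ab}$ are the $R$-matrices, in the chosen bases, of the braiding $\varepsilon$ and of its opposite $\varepsilon^{\mathrm{op}}$ respectively. If $a=b$, then $$R_{c,aa}=\omega_i^{-1}\omega_k^{1/2}(E^+-E^-),\qquad R^{\mathrm{op}}_{c,aa}=\omega_i\omega_k^{-1/2}(E^+-E^-),$$ where $E^\pm$ are orthogonal projections in the algebra of complex $N^k_{i,i}\times N^k_{i,i}$ matrices (the eigenprojections of $\varepsilon_{a,a}$ in $\mathrm{Hom}_{\mathcal{C}}(c,a\times a)$) such that $E^+E^-=0$ and $E^++E^-=\mathbf{1}_{N^k_{i,i}}$,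 and the dimensions (ranks) of $E^+$ and $E^-$ are fixed by the modular data of $\mathcal{C}$ (that is, for given choices of the square roots, they are the same for any two UMTCs with the same modular data).
   Context: A unitary modular tensor category (UMTC) $\mathcal{C}$ is a strict unitary fusion category (a $C^*$-tensor category with finite-dimensional Hom spaces, finite direct sums, subobjects, conjugates, finitely many isomorphism classes of irreducible objects, and irreducible tensor unit $\mathrm{id}$) equipped with a unitary braiding $\varepsilon_{a,b}\in\mathrm{Hom}_{\mathcal{C}}(a\times b,b\times a)$ which is modular, i.e. the matrix $S$ below is invertible. The tensor product is written $\times$, the adjoint of a morphism $t$ is $t^*$, and $\overline a$ denotes a conjugate (dual) of $a$. The opposite braiding is $\varepsilon^{\mathrm{op}}_{a,b}:=(\varepsilon_{b,a})^{-1}=(\varepsilon_{b,a})^*$. Modular data $\{n,\Delta,N,S,T\}$: $n+1$ is the rank; the spectrum $\Delta$ is the set of unitary isomorphism classes of irreducible objects, labelled by $0,\dots,n$, with $0$ the class of $\mathrm{id}$; with $a_i$ a representative of class $i$, the fusion rules are $N^k_{i,j}=\dim\mathrm{Hom}_{\mathcal{C}}(a_k,a_i\times a_j)$. Let $d_i>0$ be the intrinsic (quantum) dimension of $a_i$. If $r\in\mathrm{Hom}_{\mathcal C}(\mathrm{id},\overline{a_i}\times a_i)$ is part of a standard solution of the conjugate equations (so $r^*\circ r=d_i$), the phase $\omega_i$ is defined by $(r^*\times 1_{a_i})\circ(1_{\overline{a_i}}\times\varepsilon_{a_i,a_i})\circ(r\times 1_{a_i})=\omega_i1_{a_i}$.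 Put $Y_{i,j}=\sum_kN^k_{i,j}\frac{\omega_i\omega_j}{\omega_k}d_k$, $\sigma=\sum_id_i^2\omega_i^{-1}$, $S_{i,j}=|\sigma|^{-1}Y_{i,j}$, $T_{i,j}=(\sigma/|\sigma|)^{1/3}\omega_i\delta_{i,j}$. Then $d_i=S_{0,i}/S_{0,0}$ and $\omega_i=T_{i,i}/T_{0,0}$. Two UMTCs have the same modular data if these data agree after identifying their spectra. Orthonormal basis of isometries of $\mathrm{Hom}_{\mathcal{C}}(c,a\times b)$ means a linear basis with $(t^e_{c,ab})^*\circ t^{e'}_{c,ab}=\delta_{e,e'}1_c$. Given such bases, the $R$-matrices are the square matrices of size $N^k_{i,j}=N^k_{j,i}$ with entries $$(R_{c,ab})^{e,f}:=(t^f_{c,ba})^*\circ\varepsilon_{a,b}\circ t^e_{c,ab},\qquad(R^{\mathrm{op}}_{c,ab})^{e,f}:=(t^f_{c,ba})^*\circ\varepsilon^{\mathrm{op}}_{a,b}\circ t^e_{c,ab},$$ elements of $\mathrm{Hom}_{\mathcal C}(c,c)=\mathbb{C}1_c$ regarded as complex numbers. Square roots: fixed choices of the square roots $(\omega_k/(\omega_i\omega_j))^{1/2}$ (the same for $(i,j,k)$ and $(j,i,k)$, $i\ne j$) and $\omega_k^{1/2}$ are understood; $(\omega_i\omega_j/\omega_k)^{1/2}$ and $\omega_k^{-1/2}$ denote their inverses. The eigenprojections are those of the linear operator $t\mapsto\varepsilon_{a,a}\circ t$ on $\mathrm{Hom}_{\mathcal C}(c,a\times a)$ for the only possible eigenvalues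 $\pm\omega_i^{-1}\omega_k^{1/2}$, where a projection $P$ is represented by the matrix with $(e,f)$ entry $(t^f_{c,aa})^*\circ P(t^e_{c,aa})$. *)

(* Defs.v *)
From HB Require Import structures.
From mathcomp Require Import all_boot all_order all_algebra.
From mathcomp Require Import complex.
From mathcomp Require Import boolp classical_sets reals.

Set Implicit Arguments.
Unset Strict Implicit.
Unset Printing Implicit Defensive.

Import Order.TTheory GRing.Theory Num.Theory.
Local Open Scope ring_scope.

Declare Scope cat_scope.
Delimit Scope cat_scope with cat.

Reserved Notation "g \@ f" (at level 45, right associativity).
Reserved Notation "f ^\dag" (at level 1, left associativity, format "f ^\dag").
Reserved Notation "a \ox b" (at level 40, left associativity).
Reserved Notation "f \oxm g" (at level 40, left associativity).

(* The complex numbers are R[i] for R : realType. Hom spaces are vectTypes,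
   hence finite dimensional. The norm takes values in R[i], as in the
   norms of MathComp; its values are real by hnorm_ge0. *)
Record star_cat_data (R : realType) := StarCatData {
  obj :> Type;
  hom : obj -> obj -> vectType R[i];
  comp : forall a b c : obj, hom b c -> hom a b -> hom a c;
  one : forall a : obj, hom a a;
  adj : forall a b : obj, hom a b -> hom b a;
  hnorm : forall a b : obj, hom a b -> R[i] }.

Arguments comp {R s a b c} g f : rename.
Arguments one {R s} a : rename.
Arguments adj {R s a b} f : rename.
Arguments hnorm {R s a b} f : rename.

Notation "g \@ f" := (comp g f) : cat_scope.
Notation "f ^\dag" := (adj f) : cat_scope.
Local Open Scope cat_scope.

(* g \@ f is g after f. Completeness of the Hom spaces is automatic in finite
   dimension. *)
Record is_cstar_category (R : realType) (C : star_cat_data R) : Prop := {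
  comp_assoc : forall (a b c d : C)
    (h : hom c d) (g : hom b c) (f : hom a b), h \@ (g \@ f) = (h \@ g) \@ f;
  comp1m : forall (a b : C) (f : hom a b), one b \@ f = f;
  compm1 : forall (a b : C) (f : hom a b), f \@ one a = f;
  comp_linearl : forall (a b c : C) (z : R[i]) (g g' : hom b c) (f : hom a b),
    (z *: g + g') \@ f = z *: (g \@ f) + g' \@ f;
  comp_linearr : forall (a b c : C) (z : R[i]) (g : hom b c) (f f' : hom a b),
    g \@ (z *: f + f') = z *: (g \@ f) + g \@ f';
  adj_antilinear : forall (a b : C) (z : R[i]) (f f' : hom a b),
    (z *: f + f')^\dag = z^* *: f^\dag + f'^\dag;
  adjK : forall (a b : C) (f : hom a b), f^\dag^\dag = f;
  adj_comp : forall (a b c : C) (g : hom b c) (f : hom a b),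
    (g \@ f)^\dag = f^\dag \@ g^\dag;
  hnorm_ge0 : forall (a b : C) (f : hom a b), 0 <= hnorm f;
  hnorm_eq0 : forall (a b : C) (f : hom a b), hnorm f = 0 -> f = 0;
  hnormD : forall (a b : C) (f g : hom a b),
    hnorm (f + g) <= hnorm f + hnorm g;
  hnormZ : forall (a b : C) (z : R[i]) (f : hom a b),
    hnorm (z *: f) = `|z| * hnorm f;
  hnorm_comp : forall (a b c : C) (g : hom b c) (f : hom a b),
    hnorm (g \@ f) <= hnorm g * hnorm f;
  hnorm_cstar : forall (a b : C) (f : hom a b),
    hnorm (f^\dag \@ f) = hnorm f ^+ 2;
  adj_pos : forall (a b : C) (f : hom a b),
    exists g : hom a a, f^\dag \@ f = g^\dag \@ g }.

Definition irreducible (R : realType) (C : star_cat_data R) (a : C) : Prop :=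
  \dim {: hom a a} = 1%N.

Definition isometry (R : realType) (C : star_cat_data R) (a b : C)
    (v : hom a b) : Prop :=
  v^\dag \@ v = one a.

Definition unitary (R : realType) (C : star_cat_data R) (a b : C)
    (u : hom a b) : Prop :=
  u^\dag \@ u = one a /\ u \@ u^\dag = one b.

Definition unitarily_isomorphic (R : realType) (C : star_cat_data R)
    (a b : C) : Prop :=
  exists u : hom a b, unitary u.

(* The complex number z such that f = z 1_c, for c irreducible. *)
Definition scal (R : realType) (C : star_cat_data R) (c : C)
    (f : hom c c) : R[i] :=
  coord [tuple one c] ord0 f.

(* The identity morphism between equal objects: strictness gives equalities of
   objects that do not hold by conversion. *)
Definition eqm (R : realType) (C : star_cat_data R) (a b : C) (e : a = b) :
    hom a b :=
  match e in _ = b' return hom a b' with erefl => one a end.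

Record tensor_cat_data (R : realType) := TensorCatData {
  tensor_star :> star_cat_data R;
  tunit : tensor_star;
  tens : tensor_star -> tensor_star -> tensor_star;
  tensm : forall a a' b b' : tensor_star,
    hom a a' -> hom b b' -> hom (tens a b) (tens a' b');
  tensA : forall a b c, tens (tens a b) c = tens a (tens b c);
  tens1o : forall a, tens tunit a = a;
  tenso1 : forall a, tens a tunit = a }.

Arguments tunit {R t} : rename.
Arguments tens {R t} a b : rename.
Arguments tensm {R t a a' b b'} f g : rename.
Arguments tensA {R t} a b c : rename.
Arguments tens1o {R t} a : rename.
Arguments tenso1 {R t} a : rename.

Notation "a \ox b" := (tens a b) : cat_scope.
Notation "f \oxm g" := (tensm f g) : cat_scope.

Section TensorCategories.
Variables (R : realType) (C : tensor_cat_data R).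
Implicit Types a b c : C.

Definition assoc a b c : hom ((a \ox b) \ox c) (a \ox (b \ox c)) :=
  eqm (tensA a b c).
Definition assocV a b c : hom (a \ox (b \ox c)) ((a \ox b) \ox c) :=
  eqm (esym (tensA a b c)).
Definition lunit a : hom (tunit \ox a) a := eqm (tens1o a).
Definition lunitV a : hom a (tunit \ox a) := eqm (esym (tens1o a)).
Definition runit a : hom (a \ox tunit) a := eqm (tenso1 a).
Definition runitV a : hom a (a \ox tunit) := eqm (esym (tenso1 a)).

Record is_strict_tensor : Prop := {
  tensm_linearl : forall a a' b b' (z : R[i]) (f f' : hom a a') (g : hom b b'),
    (z *: f + f') \oxm g = z *: (f \oxm g) + f' \oxm g;
  tensm_linearr : forall a a' b b' (z : R[i]) (f : hom a a') (g g' : hom b b'),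
    f \oxm (z *: g + g') = z *: (f \oxm g) + f \oxm g';
  tensm1 : forall a b, one a \oxm one b = one (a \ox b);
  tensm_comp : forall a a' a'' b b' b''
    (f' : hom a' a'') (f : hom a a') (g' : hom b' b'') (g : hom b b'),
    (f' \@ f) \oxm (g' \@ g) = (f' \oxm g') \@ (f \oxm g);
  tensm_adj : forall a a' b b' (f : hom a a') (g : hom b b'),
    (f \oxm g)^\dag = f^\dag \oxm g^\dag;
  tensmA : forall a a' b b' c c' (f : hom a a') (g : hom b b') (h : hom c c'),
    assoc a' b' c' \@ ((f \oxm g) \oxm h) = (f \oxm (g \oxm h)) \@ assoc a b c;
  tens1m : forall a a' (f : hom a a'),
    lunit a' \@ (one tunit \oxm f) = f \@ lunit a;
  tensm1r : forall a a' (f : hom a a'),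
    runit a' \@ (f \oxm one tunit) = f \@ runit a }.

Definition conjugate_equations a abar
    (r : hom tunit (abar \ox a)) (rbar : hom tunit (a \ox abar)) : Prop :=
  lunit a \@ (rbar^\dag \oxm one a) \@ assocV a abar a \@ (one a \oxm r)
    \@ runitV a = one a
  /\ lunit abar \@ (r^\dag \oxm one abar) \@ assocV abar a abar
    \@ (one abar \oxm rbar) \@ runitV abar = one abar.

(* For irreducible a, which is the only case used, a solution of the conjugate
   equations is standard exactly when it is normalized in this way. *)
Definition standard_solution a abar
    (r : hom tunit (abar \ox a)) (rbar : hom tunit (a \ox abar)) : Prop :=
  conjugate_equations r rbar /\ r^\dag \@ r = rbar^\dag \@ rbar.

Record is_fusion : Prop := {
  unit_irreducible : irreducible (tunit : C);
  direct_sums : forall a b, exists c (v : hom a c) (w : hom b c),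
    [/\ isometry v, isometry w & v \@ v^\dag + w \@ w^\dag = one c];
  subobjects : forall a (p : hom a a), p != 0 -> p \@ p = p -> p^\dag = p ->
    exists b (v : hom b a), isometry v /\ v \@ v^\dag = p;
  conjugates : forall a, exists abar
    (r : hom tunit (abar \ox a)) (rbar : hom tunit (a \ox abar)),
    conjugate_equations r rbar;
  finite_spectrum : exists n (x : 'I_n -> C),
    forall a, irreducible a -> exists i, unitarily_isomorphic a (x i) }.

(* x chooses one representative in each unitary isomorphism class of irreducible
   objects; the labels are 0, ..., n, and 0 labels the class of the unit. *)
Definition is_spectrum n (x : 'I_n.+1 -> C) : Prop :=
  [/\ forall i, irreducible (x i),
      forall i j, unitarily_isomorphic (x i) (x j) -> i = j,
      forall a, irreducible a -> exists i, unitarily_isomorphic a (x i)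
    & unitarily_isomorphic (x ord0) tunit].

(* The d such that r^\dag r = d 1 for a standard solution (r, rbar); it does not
   depend on the solution. *)
Definition qdim a : R[i] :=
  xget 0 [set d | exists abar
    (r : hom tunit (abar \ox a)) (rbar : hom tunit (a \ox abar)),
    standard_solution r rbar /\ r^\dag \@ r = d *: one tunit]%classic.

(* N^k_{i,j} is fusion x i j k. *)
Definition fusion n (x : 'I_n.+1 -> C) (i j k : 'I_n.+1) : nat :=
  \dim {: hom (x k) (x i \ox x j)}.

End TensorCategories.

Record braided_cat_data (R : realType) := BraidedCatData {
  braided_tensor :> tensor_cat_data R;
  braid : forall a b : braided_tensor, hom (a \ox b) (b \ox a) }.

Arguments braid {R b} a b : rename.

Section BraidedCategories.
Variables (R : realType) (C : braided_cat_data R).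
Implicit Types a b c : C.

Record is_unitary_braiding : Prop := {
  braid_unitary : forall a b, unitary (braid a b);
  braid_natural : forall a a' b b' (f : hom a a') (g : hom b b'),
    braid a' b' \@ (f \oxm g) = (g \oxm f) \@ braid a b;
  hexagonr : forall a b c,
    assoc b c a \@ braid a (b \ox c) \@ assoc a b c
    = (one b \oxm braid a c) \@ assoc b a c \@ (braid a b \oxm one c);
  hexagonl : forall a b c,
    assocV c a b \@ braid (a \ox b) c \@ assocV a b c
    = (braid a c \oxm one b) \@ assocV a c b \@ (one a \oxm braid b c) }.

Definition braid_op a b : hom (a \ox b) (b \ox a) := (braid b a)^\dag.

(* The omega such that
   (r^\dag x 1_a) o (1_abar x braid a a) o (r x 1_a) = omega 1_a
   for a standard solution (r, rbar); it does not depend on the solution. *)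
Definition phase a : R[i] :=
  xget 0 [set w | exists abar
    (r : hom tunit (abar \ox a)) (rbar : hom tunit (a \ox abar)),
    standard_solution r rbar /\
    lunit a \@ (r^\dag \oxm one a) \@ assocV abar a a
      \@ (one abar \oxm braid a a)
      \@ assoc abar a a \@ (r \oxm one a) \@ lunitV a = w *: one a]%classic.

Section ModularData.
Variables (n : nat) (x : 'I_n.+1 -> C).

Definition matrixY : 'M[R[i]]_n.+1 :=
  \matrix_(i, j) \sum_k (fusion x i j k)%:R
    * (phase (x i) * phase (x j) / phase (x k)) * qdim (x k).

Definition sigma : R[i] := \sum_i qdim (x i) ^+ 2 * (phase (x i))^-1.

Definition matrixS : 'M[R[i]]_n.+1 := `|sigma|^-1 *: matrixY.

Definition matrixT : 'M[R[i]]_n.+1 :=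
  \matrix_(i, j) (3.-root (sigma / `|sigma|) * phase (x i) *+ (i == j)).

End ModularData.

End BraidedCategories.

(* The identification of the spectra is carried by the labellings x and x'. *)
Definition same_modular_data (R : realType) (C C' : braided_cat_data R) n
    (x : 'I_n.+1 -> C) (x' : 'I_n.+1 -> C') : Prop :=
  [/\ forall i j k, fusion x i j k = fusion x' i j k,
      matrixS x = matrixS x'
    & matrixT x = matrixT x'].

Record umtc (R : realType) := Umtc {
  umtc_braided :> braided_cat_data R;
  umtc_cstar : is_cstar_category umtc_braided;
  umtc_tensor : is_strict_tensor umtc_braided;
  umtc_fusion : is_fusion umtc_braided;
  umtc_braiding : is_unitary_braiding umtc_braided;
  umtc_modular : forall n (x : 'I_n.+1 -> umtc_braided),
    is_spectrum x -> matrixS x \in unitmx }.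

Section RMatrices.
Variables (R : realType) (C : umtc R) (n : nat) (x : 'I_n.+1 -> C).

Lemma fusion_le i j k : (fusion x i j k <= fusion x j i k)%N.
Proof.
have [c1 c2 c3 c4 c5 _ _ _ _ _ _ _ _ _ _] := umtc_cstar C.
have [bU _] := braid_unitary (umtc_braiding C) (x i) (x j).
pose f (t : hom (x k) (x i \ox x j)) := braid (x i) (x j) \@ t.
have fL : linear f by move=> z u v; rewrite /f c5.
pose HB := GRing.isLinear.Build _ _ _ _ f fL.
pose fl : {linear _ -> _} := HB.pack f HB.
have fE t : linfun fl t = f t by rewrite lfunE.
have ker0 : lker (linfun fl) == 0%VS.
  apply/lker0P => u v; rewrite !fE /f => uv.
  by rewrite -[u]c2 -[v]c2 -bU -!c1 uv.
rewrite /fusion -(limg_dim_eq (f := linfun fl)) ?dimvS ?subvf //.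
by rewrite (eqP ker0) capv0.
Qed.

Lemma fusionC i j k : fusion x i j k = fusion x j i k.
Proof. by apply/eqP; rewrite eqn_leq !fusion_le. Qed.

(* t i j k is a family t^e of elements of Hom(x k, x i \ox x j). *)
Definition hom_families : Type :=
  forall i j k : 'I_n.+1,
    (fusion x i j k).-tuple (hom (x k) (x i \ox x j)).

Definition orthonormal_bases (t : hom_families) : Prop :=
  forall i j k,
    basis_of fullv (t i j k) /\
    forall e f, (tnth (t i j k) e)^\dag \@ tnth (t i j k) f
      = (e == f)%:R *: one (x k).

(* Entry (e, f) is (t^f_{k,ji})^\dag o b o t^e_{k,ij}. *)
Definition braiding_mx (b : forall a a' : C, hom (a \ox a') (a' \ox a))
    (t : hom_families) (i j k : 'I_n.+1) : 'M[R[i]]_(fusion x i j k) :=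
  \matrix_(e, f) scal ((tnth (t j i k) (cast_ord (fusionC i j k) f))^\dag
    \@ b (x i) (x j) \@ tnth (t i j k) e).

Definition Rmx := braiding_mx (@braid R C).
Definition Rmx_op := braiding_mx (@braid_op R C).

Definition braid_end (i k : 'I_n.+1) : 'End(hom (x k) (x i \ox x i)) :=
  linfun (fun t : hom (x k) (x i \ox x i) => braid (x i) (x i) \@ t).

(* Entry (e, f) is (t^f_{k,ii})^\dag o P(t^e_{k,ii}). *)
Definition end_mx (t : hom_families) (i k : 'I_n.+1)
    (P : 'End(hom (x k) (x i \ox x i))) : 'M[R[i]]_(fusion x i i k) :=
  \matrix_(e, f) scal ((tnth (t i i k) f)^\dag \@ P (tnth (t i i k) e)).

End RMatrices.

(* The projection onto Ker(phi - l) along Im(phi - l); it vanishes if l is not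
   an eigenvalue. *)
Definition eigenproj (K : fieldType) (V : vectType K) (phi : 'End(V)) (l : K) :
    'End(V) :=
  daddv_pi (passmx.leigenspace phi l) (limg (phi - l *: \1%VF)).

Definition orthogonal_projection (R : realType) m (E : 'M[R[i]]_m) : Prop :=
  E *m E = E /\ map_mx Num.conj E^T = E.

(* Main.v *)
From Pilot Require Import Defs.
From HB Require Import structures.
From mathcomp Require Import all_boot all_order all_algebra.
From mathcomp Require Import complex.
From mathcomp Require Import boolp classical_sets reals.
(* [hom] is also the name of a notion of the algebra library. *)
Import Pilot.Defs.

Set Implicit Arguments.
Unset Strict Implicit.
Unset Printing Implicit Defensive.

Import Order.TTheory GRing.Theory Num.Theory.
Local Open Scope ring_scope.
Local Open Scope cat_scope.

(** Write [omega] for [phase] and [d] for [qdim]. The statement rests on two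
    facts.

    The first is that the double braiding acts on [hom c (b \ox a)], for
    irreducible [a], [b] and [c], as the scalar [omega c / (omega a * omega b)]
    ([double_braid]). The twist of an object [X] is the partial trace of its
    self-braiding. For [X = b \ox a], the hexagons and the Yang-Baxter equation
    turn it into [omega a * omega b] times the double braiding
    ([heq_ptr_br_tens]). Naturality of the twist along [t : hom c X] is only
    clear up to the operator [P] that rotates [t] around the loop of the trace
    ([ptr_rotate], [twist_rotate]); so [P] is, up to a phase, the inverse of the
    double braiding, hence an isometry of [hom c X]. It is also positive for the
    inner product that the trace over [X] defines. Therefore it is the identity,
    which gives the action of the double braiding and, at the same time, the
    traciality of the trace ([ptr_rank_one]).

    For [i != j] this suffices: a basis of [hom (x k) (x j \ox x i)] is obtained
    by braiding one of [hom (x k) (x i \ox x j)] and dividing it by the square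
    root. For [i = j] the braiding squares to a scalar [lambda ^+ 2] on
    [hom (x k) (x i \ox x i)], so that it is [lambda] times the difference of
    its two eigenprojections. The ranks of these are given by the trace of the
    braiding and by the fusion coefficient ([rank_eigenproj]).

    The second fact is that this trace is a function of the modular data. Let a
    strand [x j] encircle the two strands of the self-braiding of [a = x i], and
    close the diagram. On the channel [x k] the encircling strand contributes
    the scalar [(matrixY x j k)^* / d (x k)]. On the other hand, the Yang-Baxter
    equation moves the self-braiding of [a] out, where it contributes the factor
    [omega a], and leaves the closure of the square of the double braiding of
    [a] with [x j]. As the trace factors through partial traces ([qtr_ptr],
    deduced from semisimplicity), this is the linear system
    [braid_trace_equation] for the traces; its matrix is invertible because the
    category is modular. *)

(** * C*-categories *)

Section CStarCategory.
Variables (R : realType) (C : umtc R).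
Implicit Types a b c d : C.

Lemma compA a b c d (h : hom c d) (g : hom b c) (f : hom a b) :
  h \@ (g \@ f) = (h \@ g) \@ f.
Proof. exact: comp_assoc (umtc_cstar C) _ _ _ _ _ _ _. Qed.

Lemma id_comp a b (f : hom a b) : one b \@ f = f.
Proof. exact: comp1m (umtc_cstar C) _ _ _. Qed.

Lemma comp_id a b (f : hom a b) : f \@ one a = f.
Proof. exact: compm1 (umtc_cstar C) _ _ _. Qed.

Lemma compDl a b c (g g' : hom b c) (f : hom a b) :
  (g + g') \@ f = g \@ f + g' \@ f.
Proof.
by have := comp_linearl (umtc_cstar C) 1 g g' f; rewrite !scale1r.
Qed.

Lemma compDr a b c (g : hom b c) (f f' : hom a b) :
  g \@ (f + f') = g \@ f + g \@ f'.
Proof.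
by have := comp_linearr (umtc_cstar C) 1 g f f'; rewrite !scale1r.
Qed.

Lemma comp0m a b c (f : hom a b) : (0 : hom b c) \@ f = 0.
Proof. by apply: (addrI (0 \@ f)); rewrite -compDl !addr0. Qed.

Lemma compm0 a b c (g : hom b c) : g \@ (0 : hom a b) = 0.
Proof. by apply: (addrI (g \@ 0)); rewrite -compDr !addr0. Qed.

Lemma compZl a b c (z : R[i]) (g : hom b c) (f : hom a b) :
  (z *: g) \@ f = z *: (g \@ f).
Proof.
by have := comp_linearl (umtc_cstar C) z g 0 f; rewrite comp0m !addr0.
Qed.

Lemma compZr a b c (z : R[i]) (g : hom b c) (f : hom a b) :
  g \@ (z *: f) = z *: (g \@ f).
Proof.
by have := comp_linearr (umtc_cstar C) z g f 0; rewrite compm0 !addr0.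
Qed.

Lemma compNl a b c (g : hom b c) (f : hom a b) : (- g) \@ f = - (g \@ f).
Proof. by rewrite -[- g]scaleN1r compZl scaleN1r. Qed.

Lemma compNr a b c (g : hom b c) (f : hom a b) : g \@ (- f) = - (g \@ f).
Proof. by rewrite -[- f]scaleN1r compZr scaleN1r. Qed.

Lemma comp_suml a b c I (s : seq I) (P : pred I) (G : I -> hom b c)
    (f : hom a b) :
  (\sum_(i <- s | P i) G i) \@ f = \sum_(i <- s | P i) (G i \@ f).
Proof.
apply: (big_rec2 (fun g h => g \@ f = h)) => [|i g g' _ <-].
  exact: comp0m.
by rewrite compDl.
Qed.

Lemma comp_sumr a b c I (s : seq I) (P : pred I) (F : I -> hom a b)
    (g : hom b c) :
  g \@ (\sum_(i <- s | P i) F i) = \sum_(i <- s | P i) (g \@ F i).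
Proof.
apply: (big_rec2 (fun f h => g \@ f = h)) => [|i f f' _ <-].
  exact: compm0.
by rewrite compDr.
Qed.

Lemma dagK a b (f : hom a b) : f^\dag^\dag = f.
Proof. exact: adjK (umtc_cstar C) _ _ _. Qed.

Lemma dag_comp a b c (g : hom b c) (f : hom a b) :
  (g \@ f)^\dag = f^\dag \@ g^\dag.
Proof. exact: adj_comp (umtc_cstar C) _ _ _ _ _. Qed.

Lemma dagD a b (f g : hom a b) : (f + g)^\dag = f^\dag + g^\dag.
Proof.
by have := adj_antilinear (umtc_cstar C) 1 f g; rewrite rmorph1 !scale1r.
Qed.

Lemma dag0 a b : (0 : hom a b)^\dag = 0.
Proof. by apply: (addrI (0^\dag)); rewrite -dagD !addr0. Qed.

Lemma dagZ a b (z : R[i]) (f : hom a b) : (z *: f)^\dag = z^* *: f^\dag.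
Proof.
by have := adj_antilinear (umtc_cstar C) z f 0; rewrite dag0 !addr0.
Qed.

Lemma dagN a b (f : hom a b) : (- f)^\dag = - f^\dag.
Proof. by rewrite -[- f]scaleN1r dagZ rmorphN1 scaleN1r. Qed.

Lemma dag_sum a b I (s : seq I) (P : pred I) (F : I -> hom a b) :
  (\sum_(i <- s | P i) F i)^\dag = \sum_(i <- s | P i) (F i)^\dag.
Proof.
apply: (big_rec2 (fun f h => f^\dag = h)) => [|i f f' _ <-].
  exact: dag0.
by rewrite dagD.
Qed.

Lemma dag1 a : (one a)^\dag = one a.
Proof. by rewrite -[LHS]id_comp -{1}[one a]dagK -dag_comp id_comp dagK. Qed.

Lemma dag_inj a b : injective (@adj R C a b).
Proof. exact: can_inj (@dagK a b). Qed.

Lemma dag_self_eq0 a b (f : hom a b) : f^\dag \@ f = 0 -> f = 0.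
Proof.
move=> f0; apply: (hnorm_eq0 (umtc_cstar C)).
apply/eqP; rewrite -sqrf_eq0 -(hnorm_cstar (umtc_cstar C)) f0.
by rewrite -(scale0r (0 : hom a a)) (hnormZ (umtc_cstar C)) normr0 mul0r.
Qed.

(** ** Irreducible objects *)

Lemma irr_neq0 a : irreducible a -> one a != 0.
Proof.
move=> ha; apply/eqP => h0.
have /eqP : \dim {: hom a a} = 0%N.
  apply/eqP; rewrite dimv_eq0; apply/eqP/vspaceP => f.
  by rewrite memvf memv0 -[f]id_comp h0 comp0m eqxx.
by rewrite ha.
Qed.

Lemma scalE a (f : hom a a) : irreducible a -> f = scal f *: one a.
Proof.
move=> ha; have hb : basis_of fullv [tuple one a].
  rewrite basisEfree /= subvf ha leqnn !andbT.
  by rewrite seq1_free irr_neq0.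
have := coord_basis hb (memvf f); rewrite big_ord1 /=; exact.
Qed.

Lemma scal_id a z : irreducible a -> scal (z *: one a) = z.
Proof.
move=> ha; have /eqP := scalE (z *: one a) ha.
rewrite -subr_eq0 -scalerBl scaler_eq0 (negPf (irr_neq0 ha)) orbF subr_eq0.
by move/eqP.
Qed.

Lemma scal1 a : irreducible a -> scal (one a) = 1.
Proof. by move=> ha; rewrite -[one a]scale1r scal_id. Qed.

Lemma scalP a (f : hom a a) z : irreducible a -> f = z *: one a -> scal f = z.
Proof. by move=> ha ->; rewrite scal_id. Qed.

Lemma scal0 a : irreducible a -> scal (0 : hom a a) = 0.
Proof. by move=> _; rewrite /scal linear0. Qed.

Lemma scalD a (f g : hom a a) : scal (f + g) = scal f + scal g.
Proof. by rewrite /scal linearD. Qed.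

Lemma scalZ a z (f : hom a a) : scal (z *: f) = z * scal f.
Proof. by rewrite /scal linearZ. Qed.

Lemma scal_sum a I (s : seq I) (P : pred I) (F : I -> hom a a) :
  scal (\sum_(i <- s | P i) F i) = \sum_(i <- s | P i) scal (F i).
Proof. by rewrite /scal linear_sum. Qed.

Lemma scal_comp a (f g : hom a a) : irreducible a ->
  scal (f \@ g) = scal f * scal g.
Proof.
move=> ha; apply: scalP => //; rewrite {1}(scalE f ha) {1}(scalE g ha).
by rewrite compZl compZr id_comp scalerA.
Qed.

Lemma scal_dag a (f : hom a a) : irreducible a -> scal (f^\dag) = (scal f)^*.
Proof.
by move=> ha; apply: scalP => //; rewrite {1}(scalE f ha) dagZ dag1.
Qed.

Lemma scal_dag_ge0 a b (f : hom a b) : irreducible a ->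
  0 <= scal (f^\dag \@ f).
Proof.
move=> ha; have [g ->] := adj_pos (umtc_cstar C) f.
by rewrite scal_comp // scal_dag // mulrC mul_conjC_ge0.
Qed.

Lemma scal_dag_eq0 a b (f : hom a b) : irreducible a ->
  scal (f^\dag \@ f) = 0 -> f = 0.
Proof.
move=> ha h; apply: dag_self_eq0.
by rewrite (scalE (_ \@ _) ha) h scale0r.
Qed.

Lemma scal_dag_gt0 a b (f : hom a b) : irreducible a -> f != 0 ->
  0 < scal (f^\dag \@ f).
Proof.
move=> ha f0; rewrite lt_neqAle scal_dag_ge0 // andbT eq_sym.
by apply: contraNneq f0 => /(scal_dag_eq0 ha)->.
Qed.

End CStarCategory.

(** * Strictness, whiskering and natural families *)

(** A morphism of a strict tensor category may be read with different, only
    propositionally equal, sources and targets. [heq f g] says that [f] and [g]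
    are the same morphism up to such identifications; the structural maps
    [assoc], [lunit], [runit] then become identities. *)
Definition heq (R : realType) (C : umtc R) (a b a' b' : C)
    (f : hom a b) (g : hom a' b') : Prop :=
  exists (ea : a = a') (eb : b = b'), g = eqm eb \@ f \@ eqm (esym ea).

Section Strictness.
Variables (R : realType) (C : umtc R).
Implicit Types a b c d : C.

Lemma heq_refl a b (f : hom a b) : heq f f.
Proof. by exists erefl, erefl; rewrite id_comp comp_id. Qed.

Lemma heq_sym a b a' b' (f : hom a b) (g : hom a' b') : heq f g -> heq g f.
Proof.
by case=> ea [eb ->]; case: _ / ea; case: _ / eb;
  rewrite id_comp comp_id; apply: heq_refl.
Qed.

Lemma heq_trans a b a' b' a'' b'' (f : hom a b) (g : hom a' b')
    (h : hom a'' b'') : heq f g -> heq g h -> heq f h.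
Proof.
by case=> ea [eb ->]; case: _ / ea; case: _ / eb; rewrite id_comp comp_id.
Qed.

Lemma heq_via a' b' (g : hom a' b') a b (f : hom a b) a'' b''
    (h : hom a'' b'') : heq f g -> heq g h -> heq f h.
Proof. exact: heq_trans. Qed.

Lemma heqE a b (f g : hom a b) : heq f g -> f = g.
Proof.
case=> ea [eb ->]; rewrite (Prop_irrelevance ea erefl).
by rewrite (Prop_irrelevance eb erefl) id_comp comp_id.
Qed.

Lemma heq_comp a b c a' b' c' (g : hom b c) (f : hom a b)
    (g' : hom b' c') (f' : hom a' b') :
  heq g g' -> heq f f' -> heq (g \@ f) (g' \@ f').
Proof.
case=> eb [ec ->]; case=> ea [eb' ->].
case: _ / ea; case: _ / ec; case: _ / eb eb' => eb'.
rewrite (Prop_irrelevance eb' erefl) !id_comp !comp_id; exact: heq_refl.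
Qed.

Lemma heq_tens a b c d a' b' c' d' (f : hom a b) (g : hom c d)
    (f' : hom a' b') (g' : hom c' d') :
  heq f f' -> heq g g' -> heq (f \oxm g) (f' \oxm g').
Proof.
case=> ea [eb ->]; case=> ec [ed ->].
case: _ / ea; case: _ / eb; case: _ / ec; case: _ / ed.
rewrite !id_comp !comp_id; exact: heq_refl.
Qed.

Lemma heq_dag a b a' b' (f : hom a b) (f' : hom a' b') :
  heq f f' -> heq f^\dag f'^\dag.
Proof.
case=> ea [eb ->]; case: _ / ea; case: _ / eb.
rewrite !id_comp !comp_id; exact: heq_refl.
Qed.

Lemma heqZ a b a' b' z (f : hom a b) (f' : hom a' b') :
  heq f f' -> heq (z *: f) (z *: f').
Proof.
case=> ea [eb ->]; case: _ / ea; case: _ / eb.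
rewrite !id_comp !comp_id; exact: heq_refl.
Qed.

Lemma heq_eqm a b (e : a = b) : heq (eqm e) (one a).
Proof. by case: _ / e; apply: heq_refl. Qed.

Lemma heq_eqm_r a b (e : a = b) : heq (eqm e) (one b).
Proof. by case: _ / e; apply: heq_refl. Qed.

Lemma heq_castl a b b' (e : b = b') (f : hom a b) : heq (eqm e \@ f) f.
Proof. by case: _ / e; rewrite id_comp; apply: heq_refl. Qed.

Lemma heq_castr a a' b (e : a = a') (f : hom a' b) : heq (f \@ eqm e) f.
Proof. by case: _ / e f => f; rewrite comp_id; apply: heq_refl. Qed.

Lemma eqm_dag a b (e : a = b) : (eqm e)^\dag = eqm (esym e).
Proof. by case: _ / e; rewrite dag1. Qed.

Lemma eqmK a b (e : a = b) (e' : b = a) : eqm e' \@ eqm e = one a.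
Proof. by apply: heqE; apply: heq_trans (heq_castl _ _) (heq_eqm e). Qed.

Lemma eqm_unitary a b (e : a = b) : unitary (eqm e : hom a b).
Proof. by split; rewrite eqm_dag eqmK. Qed.

Lemma heq_conj a a' b b' (e : b = b') (e' : a' = a) (f : hom a b) :
  heq (eqm e \@ f \@ eqm e') f.
Proof. by apply: heq_trans (heq_castl _ _) (heq_castr _ _). Qed.

Lemma tens_comp a a' a'' b b' b'' (f' : hom a' a'') (f : hom a a')
    (g' : hom b' b'') (g : hom b b') :
  (f' \oxm g') \@ (f \oxm g) = (f' \@ f) \oxm (g' \@ g).
Proof. by rewrite (tensm_comp (umtc_tensor C)). Qed.

Lemma tens_one a b : one a \oxm one b = one (a \ox b).
Proof. exact: tensm1 (umtc_tensor C) _ _. Qed.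

Lemma tens_dag a a' b b' (f : hom a a') (g : hom b b') :
  (f \oxm g)^\dag = f^\dag \oxm g^\dag.
Proof. exact: tensm_adj (umtc_tensor C) _ _ _ _ _ _. Qed.

Lemma heq_tensA a a' b b' c c' (f : hom a a') (g : hom b b') (h : hom c c') :
  heq ((f \oxm g) \oxm h) (f \oxm (g \oxm h)).
Proof.
apply: heq_trans (heq_sym (heq_castl (tensA a' b' c') _)) _.
rewrite -/(assoc _ _ _) (tensmA (umtc_tensor C)); exact: heq_castr.
Qed.

Lemma heq_tens1 a a' (f : hom a a') : heq (one tunit \oxm f) f.
Proof.
apply: heq_trans (heq_sym (heq_castl (tens1o a') _)) _.
rewrite -/(lunit _) (tens1m (umtc_tensor C)); exact: heq_castr.
Qed.

Lemma heq_tens1r a a' (f : hom a a') : heq (f \oxm one tunit) f.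
Proof.
apply: heq_trans (heq_sym (heq_castl (tenso1 a') _)) _.
rewrite -/(runit _) (tensm1r (umtc_tensor C)); exact: heq_castr.
Qed.

(** ** Whiskering *)

(* These operations are locked: rewriting with [compA] would otherwise unfold
   them in search of a composition. *)
Fact diagram_key : unit. Proof. exact: tt. Qed.

(** Tensor products with an identity on the left and on the right. *)
Definition wl a b c (f : hom b c) : hom (a \ox b) (a \ox c) :=
  locked_with diagram_key (one a \oxm f).
Definition wr b c (f : hom b c) a : hom (b \ox a) (c \ox a) :=
  locked_with diagram_key (f \oxm one a).

Lemma wlE a b c (f : hom b c) : one a \oxm f = wl a f.
Proof. by rewrite /wl locked_withE. Qed.

Lemma wrE a b c (f : hom b c) : f \oxm one a = wr f a.
Proof. by rewrite /wr locked_withE. Qed.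

Lemma wl_comp a b c d (g : hom c d) (f : hom b c) :
  wl a (g \@ f) = wl a g \@ wl a f.
Proof. by rewrite -!wlE tens_comp id_comp. Qed.

Lemma wr_comp a b c d (g : hom c d) (f : hom b c) :
  wr (g \@ f) a = wr g a \@ wr f a.
Proof. by rewrite -!wrE tens_comp id_comp. Qed.

Lemma wl1 a b : wl a (one b) = one (a \ox b).
Proof. by rewrite -wlE tens_one. Qed.

Lemma wr1 a b : wr (one b) a = one (b \ox a).
Proof. by rewrite -wrE tens_one. Qed.

Lemma wl_dag a b c (f : hom b c) : (wl a f)^\dag = wl a f^\dag.
Proof. by rewrite -!wlE tens_dag dag1. Qed.

Lemma wr_dag a b c (f : hom b c) : (wr f a)^\dag = wr f^\dag a.
Proof. by rewrite -!wrE tens_dag dag1. Qed.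

Lemma wl_wr a a' b b' (f : hom a a') (g : hom b b') :
  wr f b' \@ wl a g = wl a' g \@ wr f b.
Proof. by rewrite -!wlE -!wrE !tens_comp !id_comp !comp_id. Qed.

Lemma wlD a b c (f g : hom b c) : wl a (f + g) = wl a f + wl a g.
Proof.
have := tensm_linearr (umtc_tensor C) 1 (one a) f g.
by rewrite !scale1r !wlE.
Qed.

Lemma wl0 a b c : wl a (0 : hom b c) = 0.
Proof. by apply: (addrI (wl a 0)); rewrite -wlD !addr0. Qed.

Lemma wlZ a b c z (f : hom b c) : wl a (z *: f) = z *: wl a f.
Proof.
have := tensm_linearr (umtc_tensor C) z (one a) f 0.
by rewrite !wlE wl0 !addr0.
Qed.

Lemma wl_sum a b c I (s : seq I) (P : pred I) (F : I -> hom b c) :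
  wl a (\sum_(i <- s | P i) F i) = \sum_(i <- s | P i) wl a (F i).
Proof. exact: (big_morph (@wl a b c) (@wlD a b c) (wl0 a b c)). Qed.

Lemma wrD a b c (f g : hom b c) : wr (f + g) a = wr f a + wr g a.
Proof.
have := tensm_linearl (umtc_tensor C) 1 f g (one a).
by rewrite !scale1r !wrE.
Qed.

Lemma wr0 a b c : wr (0 : hom b c) a = 0.
Proof. by apply: (addrI (wr 0 a)); rewrite -wrD !addr0. Qed.

Lemma wrZ a b c z (f : hom b c) : wr (z *: f) a = z *: wr f a.
Proof.
have := tensm_linearl (umtc_tensor C) z f 0 (one a).
by rewrite !wrE wr0 !addr0.
Qed.

Lemma wr_sum a b c I (s : seq I) (P : pred I) (F : I -> hom b c) :
  wr (\sum_(i <- s | P i) F i) a = \sum_(i <- s | P i) wr (F i) a.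
Proof.
exact: (big_morph (fun f => @wr b c f a) (@wrD a b c) (wr0 a b c)).
Qed.

Lemma heq_wl_unit a b (f : hom a b) : heq (wl tunit f) f.
Proof. by rewrite -wlE; apply: heq_tens1. Qed.

Lemma heq_wr_unit a b (f : hom a b) : heq (wr f tunit) f.
Proof. by rewrite -wrE; apply: heq_tens1r. Qed.

Lemma heq_wl a b c a' b' c' (f : hom b c) (f' : hom b' c') :
  a = a' -> heq f f' -> heq (wl a f) (wl a' f').
Proof.
by move=> <- h; rewrite -!wlE; apply: heq_tens => //; apply: heq_refl.
Qed.

Lemma heq_wr a b c a' b' c' (f : hom b c) (f' : hom b' c') :
  a = a' -> heq f f' -> heq (wr f a) (wr f' a').
Proof.
by move=> <- h; rewrite -!wrE; apply: heq_tens => //; apply: heq_refl.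
Qed.

Lemma heq_wl_wr a b b' c (f : hom b b') : heq (wr (wl a f) c) (wl a (wr f c)).
Proof. by rewrite -!wrE -!wlE; apply: heq_tensA. Qed.

Lemma heq_wr_wr a b b' c (f : hom b b') : heq (wr (wr f a) c) (wr f (a \ox c)).
Proof. by rewrite -!wrE -tens_one; apply: heq_tensA. Qed.

Lemma heq_wl_wl a b c c' (f : hom c c') : heq (wl (a \ox b) f) (wl a (wl b f)).
Proof. by rewrite -!wlE -tens_one; apply: heq_tensA. Qed.

Lemma wl_eqm a b c (e : b = c) : wl a (eqm e) = eqm (congr1 (tens a) e).
Proof. by case: _ / e; rewrite wl1. Qed.

Lemma wr_eqm a b c (e : b = c) :
  wr (eqm e) a = eqm (congr1 (fun b => tens b a) e).
Proof. by case: _ / e; rewrite wr1. Qed.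

(** ** Natural families of structural morphisms

    The tensor products below are nested to the right, so that a string diagram
    acts on the leftmost objects of [a \ox (b \ox (c \ox X))], and morphisms
    of this form compose without any associativity isomorphism. *)

(** The braiding of the two leftmost strands. *)
Definition br a b X : hom (a \ox (b \ox X)) (b \ox (a \ox X)) :=
  locked_with diagram_key (assoc b a X \@ wr (braid a b) X \@ assocV a b X).

(** The cup [r], created to the left of [X]. *)
Definition cup a abar (r : hom tunit (abar \ox a)) X :
    hom X (abar \ox (a \ox X)) :=
  locked_with diagram_key (assoc abar a X \@ wr r X \@ lunitV X).

(** The vertex [t], applied to the leftmost strand. *)
Definition fork a b c (t : hom c (a \ox b)) X :
    hom (c \ox X) (a \ox (b \ox X)) :=
  locked_with diagram_key (assoc a b X \@ wr t X).

Lemma brE a b X :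
  br a b X = assoc b a X \@ wr (braid a b) X \@ assocV a b X.
Proof. by rewrite /br locked_withE. Qed.

Lemma cupE a abar (r : hom tunit (abar \ox a)) X :
  cup r X = assoc abar a X \@ wr r X \@ lunitV X.
Proof. by rewrite /cup locked_withE. Qed.

Lemma forkE a b c (t : hom c (a \ox b)) X :
  fork t X = assoc a b X \@ wr t X.
Proof. by rewrite /fork locked_withE. Qed.

Lemma heq_br a b X : heq (br a b X) (wr (braid a b) X).
Proof. rewrite brE; exact: heq_conj. Qed.

Lemma heq_cup a abar (r : hom tunit (abar \ox a)) X :
  heq (cup r X) (wr r X).
Proof. rewrite cupE; exact: heq_conj. Qed.

Lemma assocVK a b c : assoc a b c \@ assocV a b c = one _.
Proof. exact: eqmK. Qed.

Lemma cup_natural a abar (r : hom tunit (abar \ox a)) X Y (f : hom X Y) :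
  wl abar (wl a f) \@ cup r X = cup r Y \@ f.
Proof.
apply: heqE.
apply: (heq_via (g := wl (abar \ox a) f \@ wr r X)).
  by apply: heq_comp (heq_sym (heq_wl_wl _ _ _)) (heq_cup _ _).
rewrite -wl_wr.
by apply: heq_comp (heq_sym (heq_cup _ _)) (heq_wl_unit _).
Qed.

Lemma br_unitary a b X : unitary (br a b X).
Proof.
have [h1 h2] := braid_unitary (umtc_braiding C) a b.
have e1 := eqmK (esym (tensA a b X)) (tensA a b X).
have e2 := eqmK (tensA b a X) (esym (tensA b a X)).
have e3 := eqmK (tensA a b X) (esym (tensA a b X)).
have e4 := eqmK (esym (tensA b a X)) (tensA b a X).
split; rewrite brE !dag_comp wr_dag !eqm_dag esymK -!compA.
  rewrite [eqm _ \@ eqm (tensA b a X) \@ _]compA e2 id_comp.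
  by rewrite [wr _ _ \@ wr _ _ \@ _]compA -wr_comp h1 wr1 id_comp.
rewrite [eqm _ \@ eqm (tensA a b X) \@ _]compA eqmK id_comp.
by rewrite [wr _ _ \@ wr _ _ \@ _]compA -wr_comp h2 wr1 id_comp.
Qed.

End Strictness.

(** * Diagrams in a braided category *)

Section Diagrams.
Variables (R : realType) (C : umtc R).
Implicit Types a b c d X Y Z W : C.

(** ** Braiding *)

Lemma br_natural_over Z W W' X (g : hom W W') :
  br Z W' X \@ wl Z (wr g X) = wr g (Z \ox X) \@ br Z W X.
Proof.
apply: heqE.
apply: (heq_via (g := wr (braid Z W' \@ wl Z g) X)).
  rewrite wr_comp; apply: heq_comp (heq_br _ _ _) _.
  exact: heq_sym (heq_wl_wr _ _ _).
rewrite -(wlE Z g) (braid_natural (umtc_braiding C)) wrE wr_comp.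
by apply: heq_comp (heq_wr_wr _ _ _) (heq_sym (heq_br _ _ _)).
Qed.

Lemma br_natural_under Z W W' X (g : hom W W') :
  br W' Z X \@ wr g (Z \ox X) = wl Z (wr g X) \@ br W Z X.
Proof.
apply: heqE.
apply: (heq_via (g := wr (braid W' Z \@ wr g Z) X)).
  rewrite wr_comp; apply: heq_comp (heq_br _ _ _) _.
  exact: heq_sym (heq_wr_wr _ _ _).
rewrite -(wrE Z g) (braid_natural (umtc_braiding C)) wlE wr_comp.
by apply: heq_comp (heq_wl_wr _ _ _) (heq_sym (heq_br _ _ _)).
Qed.

Lemma heq_br_tensr Z a b X :
  heq (br Z (a \ox b) X) (wl a (br Z b X) \@ br Z a (b \ox X)).
Proof.
apply: (heq_via (g := wr (assoc a b Z \@ braid Z (a \ox b) \@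
    assoc Z a b) X)).
  by apply: heq_trans (heq_br _ _ _) (heq_wr erefl (heq_sym (heq_conj _ _ _))).
rewrite (hexagonr (umtc_braiding C)) wlE wrE !wr_comp.
apply: heq_comp.
  exact: heq_trans (heq_wl_wr _ _ _) (heq_wl erefl (heq_sym (heq_br _ _ _))).
rewrite /assoc wr_eqm; apply: heq_trans (heq_castl _ _) _.
exact: heq_trans (heq_wr_wr _ _ _) (heq_sym (heq_br _ _ _)).
Qed.

Lemma heq_br_tensl Z a b X :
  heq (br (a \ox b) Z X) (br a Z (b \ox X) \@ wl a (br b Z X)).
Proof.
apply: (heq_via (g := wr (assocV Z a b \@ braid (a \ox b) Z \@
    assocV a b Z) X)).
  by apply: heq_trans (heq_br _ _ _) (heq_wr erefl (heq_sym (heq_conj _ _ _))).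
rewrite (hexagonl (umtc_braiding C)) wlE wrE !wr_comp.
apply: heq_comp.
  exact: heq_trans (heq_wr_wr _ _ _) (heq_sym (heq_br _ _ _)).
rewrite /assocV wr_eqm; apply: heq_trans (heq_castl _ _) _.
exact: heq_trans (heq_wl_wr _ _ _) (heq_wl erefl (heq_sym (heq_br _ _ _))).
Qed.

Lemma br_tensr Z a b X :
  assoc a b (Z \ox X) \@ br Z (a \ox b) X
  = wl a (br Z b X) \@ br Z a (b \ox X) \@ wl Z (assoc a b X).
Proof.
apply: heqE; apply: heq_trans (heq_castl _ _) _.
rewrite /assoc wl_eqm compA; apply: heq_trans (heq_br_tensr _ _ _ _) _.
exact/heq_sym/heq_castr.
Qed.

Lemma heq_braid_unit Z : heq (braid Z tunit) (one Z).
Proof.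
pose e : hom Z Z := eqm (tens1o Z) \@ braid Z tunit \@ eqm (esym (tenso1 Z)).
have he : heq e (braid Z tunit) by apply: heq_conj.
have e_uni : unitary e.
  have [h1 h2] := braid_unitary (umtc_braiding C) Z tunit.
  have [k1 k2] := eqm_unitary (tens1o Z).
  have [l1 l2] := eqm_unitary (esym (tenso1 Z)).
  split; rewrite /e !dag_comp -!compA.
    by rewrite [(eqm (tens1o Z))^\dag \@ _]compA k1 id_comp
      [(braid _ _)^\dag \@ _]compA h1 id_comp l1.
  by rewrite [(eqm _) \@ (eqm (esym _))^\dag \@ _]compA l2 id_comp
    [(braid _ _) \@ _ \@ _]compA h2 id_comp k2.
have ee : e \@ e = e.
  apply: heqE; apply: (heq_via (g :=
    (assoc tunit tunit Z \@ braid Z (tunit \ox tunit) \@ assoc Z tunit tunit))).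
    rewrite (hexagonr (umtc_braiding C)) wlE wrE; apply: heq_comp.
      by apply: heq_trans he (heq_sym (heq_wl_unit _)).
    apply: heq_sym; apply: heq_trans (heq_castl _ _) _.
    by apply: heq_trans (heq_wr_unit _) (heq_sym he).
  apply: heq_trans (heq_conj _ _ _) _; apply: heq_trans _ (heq_sym he).
  by rewrite tens1o; apply: heq_refl.
have -> : one Z = e.
  by case: e_uni => h1 _; rewrite -[e]id_comp -h1 -compA ee.
exact: heq_sym.
Qed.

Lemma br_unit Z X : br Z tunit X = lunitV (Z \ox X) \@ wl Z (lunit X).
Proof.
apply: heqE; apply: heq_trans (heq_br _ _ _) _.
rewrite /lunit /lunitV wl_eqm; apply: heq_sym.
apply: heq_trans (heq_castl _ _) _; apply: heq_trans (heq_eqm_r _) _.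
by rewrite -wr1; apply: heq_wr => //; apply: heq_sym (heq_braid_unit _).
Qed.

Lemma br_fork_over Z a b c (t : hom c (a \ox b)) X :
  wl a (br Z b X) \@ br Z a (b \ox X) \@ wl Z (fork t X)
  = fork t (Z \ox X) \@ br Z c X.
Proof.
rewrite !forkE wl_comp -[RHS]compA -br_natural_over [RHS]compA br_tensr.
by rewrite -!compA.
Qed.

Lemma br_cup Z a abar (r : hom tunit (abar \ox a)) X :
  wl abar (br Z a X) \@ br Z abar (a \ox X) \@ wl Z (cup r X)
  = cup r (Z \ox X).
Proof.
have -> : cup r X = fork r X \@ lunitV X by rewrite cupE forkE compA.
have /(congr1 (fun f => f \@ wl Z (lunitV X))) := br_fork_over Z r X.
rewrite wl_comp -!compA => ->; rewrite br_unit -compA -wl_comp.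
rewrite /lunit /lunitV eqmK wl1 comp_id.
by rewrite cupE forkE -compA.
Qed.

(** The Yang-Baxter equation. *)
Lemma br_braid a b c X :
  wl c (br a b X) \@ br a c (b \ox X) \@ wl a (br b c X)
  = br b c (a \ox X) \@ wl b (br a c X) \@ br a b (c \ox X).
Proof.
have e Y : fork (braid b c) Y = br b c Y \@ assoc b c Y.
  by rewrite brE forkE -!compA /assoc /assocV eqmK comp_id.
have := br_fork_over a (braid b c) X.
rewrite !e wl_comp -!compA br_tensr.
move/(congr1 (fun f => f \@ wl a (assocV b c X))).
by rewrite -!compA -!wl_comp assocVK wl1 !comp_id.
Qed.

(** ** Partial traces *)

(** The snake identity for [a], tensored on the right with any [X]. *)
Definition snake a abar (r : hom tunit (abar \ox a))
    (rbar : hom tunit (a \ox abar)) : Prop :=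
  forall X, (cup rbar (a \ox X))^\dag \@ wl a (cup r X) = one (a \ox X).

Lemma conj_snake a abar (r : hom tunit (abar \ox a))
    (rbar : hom tunit (a \ox abar)) :
  conjugate_equations r rbar -> snake r rbar /\ snake rbar r.
Proof.
suff h a' abar' (r' : hom tunit (abar' \ox a'))
    (rbar' : hom tunit (a' \ox abar')) :
    lunit a' \@ (rbar'^\dag \oxm one a') \@ assocV a' abar' a' \@
      (one a' \oxm r') \@ runitV a' = one a' -> snake r' rbar'.
  by case=> h1 h2; split; apply: h.
move=> h X; apply: heqE.
rewrite -wr1 -h wrE wlE !wr_comp /lunit wr_eqm.
apply: heq_sym; apply: heq_trans (heq_castl _ _) _.
apply: heq_comp.
  apply: heq_trans (heq_wr_wr _ _ _) _; rewrite -wr_dag.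
  exact: heq_sym (heq_dag (heq_cup _ _)).
rewrite /assocV wr_eqm; apply: heq_trans (heq_castl _ _) _.
rewrite /runitV wr_eqm; apply: heq_trans (heq_castr _ _) _.
exact: heq_trans (heq_wl_wr _ _ _) (heq_wl erefl (heq_sym (heq_cup _ _))).
Qed.

(** The left partial trace over [a], closed with the cup [r]. *)
Definition ptr a abar (r : hom tunit (abar \ox a)) Y Z
    (f : hom (a \ox Y) (a \ox Z)) : hom Y Z :=
  (cup r Z)^\dag \@ wl abar f \@ cup r Y.

Section PartialTrace.
Variables (a abar : C) (r : hom tunit (abar \ox a)).

Lemma ptr_wll Y Z W (g : hom Z W) (f : hom (a \ox Y) (a \ox Z)) :
  ptr r (wl a g \@ f) = g \@ ptr r f.
Proof.
rewrite /ptr wl_comp !compA; congr (_ \@ _); congr (_ \@ _).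
apply: dag_inj; rewrite !dag_comp !dagK !wl_dag.
exact: cup_natural.
Qed.

Lemma ptr_wlr Y Z W (f : hom (a \ox Z) (a \ox W)) (g : hom Y Z) :
  ptr r (f \@ wl a g) = ptr r f \@ g.
Proof. by rewrite /ptr wl_comp -!compA cup_natural. Qed.

Lemma ptr_dag Y Z (f : hom (a \ox Y) (a \ox Z)) :
  ptr r f^\dag = (ptr r f)^\dag.
Proof. by rewrite /ptr !dag_comp dagK wl_dag compA. Qed.

Lemma ptrD Y Z (f g : hom (a \ox Y) (a \ox Z)) :
  ptr r (f + g) = ptr r f + ptr r g.
Proof. by rewrite /ptr wlD compDl compDr. Qed.

Lemma ptr0 Y Z : ptr r (0 : hom (a \ox Y) (a \ox Z)) = 0.
Proof. by rewrite /ptr wl0 comp0m compm0. Qed.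

Lemma ptrZ Y Z z (f : hom (a \ox Y) (a \ox Z)) :
  ptr r (z *: f) = z *: ptr r f.
Proof. by rewrite /ptr wlZ compZl compZr. Qed.

Lemma ptr_sum Y Z I (s : seq I) (P : pred I)
    (F : I -> hom (a \ox Y) (a \ox Z)) :
  ptr r (\sum_(i <- s | P i) F i) = \sum_(i <- s | P i) ptr r (F i).
Proof. exact: (big_morph (@ptr a abar r Y Z) (@ptrD Y Z) (ptr0 Y Z)). Qed.

Lemma ptr1 X z : r^\dag \@ r = z *: one tunit ->
  ptr r (one (a \ox X)) = z *: one X.
Proof.
move=> h; apply: heqE; apply: (heq_via (g := wr (r^\dag \@ r) X)).
  rewrite /ptr wl1 id_comp wr_comp; apply: heq_comp (heq_cup _ _).
  by rewrite -wr_dag; apply: heq_dag (heq_cup _ _).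
have e : z *: one X = eqm (tens1o X) \@ (z *: one (tunit \ox X)) \@
    eqm (esym (tens1o X)).
  by rewrite compZl compZr id_comp eqmK.
by rewrite h wrZ wr1 e; apply: heq_sym (heq_conj _ _ _).
Qed.

End PartialTrace.

Lemma ptr_br a abar (r : hom tunit (abar \ox a)) w X :
  lunit a \@ (r^\dag \oxm one a) \@ assocV abar a a
      \@ (one abar \oxm braid a a)
      \@ assoc abar a a \@ (r \oxm one a) \@ lunitV a = w *: one a ->
  ptr r (br a a X) = w *: one (a \ox X).
Proof.
rewrite !wrE wlE => h.
rewrite -wr1 -wrZ -h !wr_comp; apply: heqE; apply: heq_sym.
rewrite /lunit /assocV /assoc /lunitV !wr_eqm.
apply: heq_trans (heq_castl _ _) _; apply: heq_comp.
  apply: heq_trans (heq_wr_wr _ _ _) _; rewrite -wr_dag.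
  exact: heq_sym (heq_dag (heq_cup _ _)).
apply: heq_trans (heq_castl _ _) _; apply: heq_comp.
  exact: heq_trans (heq_wl_wr _ _ _) (heq_wl erefl (heq_sym (heq_br _ _ _))).
apply: heq_trans (heq_castl _ _) _; apply: heq_trans (heq_castr _ _) _.
exact: heq_trans (heq_wr_wr _ _ _) (heq_sym (heq_cup _ _)).
Qed.

(** ** Frobenius reciprocity *)

Lemma cup_wl a abar b (r : hom tunit (abar \ox a)) (f : hom a b) X :
  cup (wl abar f \@ r) X = wl abar (wr f X) \@ cup r X.
Proof.
apply: heqE; apply: heq_trans (heq_cup _ _) _; rewrite wr_comp.
exact: heq_comp (heq_wl_wr _ _ _) (heq_sym (heq_cup _ _)).
Qed.

Lemma cup_wr a abar b (r : hom tunit (abar \ox a)) (f : hom abar b) X :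
  cup (wr f a \@ r) X = wr f (a \ox X) \@ cup r X.
Proof.
apply: heqE; apply: heq_trans (heq_cup _ _) _; rewrite wr_comp.
exact: heq_comp (heq_wr_wr _ _ _) (heq_sym (heq_cup _ _)).
Qed.

Lemma cup_inj a abar (r r' : hom tunit (abar \ox a)) :
  cup r tunit = cup r' tunit -> r = r'.
Proof.
move=> h; apply: heqE; apply: heq_trans (heq_sym (heq_wr_unit _)) _.
apply: heq_trans (heq_sym (heq_cup _ _)) _; rewrite h.
exact: heq_trans (heq_cup _ _) (heq_wr_unit _).
Qed.

Lemma bend_right a abar (r : hom tunit (abar \ox a))
    (rbar : hom tunit (a \ox abar)) b (v : hom tunit (b \ox abar)) :
  snake rbar r ->
  exists f : hom a b, forall X, cup v X = wr f (abar \ox X) \@ cup rbar X.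
Proof.
move=> s; pose f := runit b \@ wl b r^\dag \@ assoc b abar a \@ wr v a \@
  lunitV a; exists f => X.
have fE Y : wr f Y = wl b (cup r Y)^\dag \@ cup v (a \ox Y).
  apply: heqE; rewrite !wr_comp /runit /assoc /lunitV !wr_eqm.
  apply: heq_trans (heq_castl _ _) _; apply: heq_comp.
    apply: heq_trans (heq_wl_wr _ _ _) _; apply: heq_wl => //.
    by rewrite -wr_dag; apply: heq_sym (heq_dag (heq_cup _ _)).
  apply: heq_trans (heq_castl _ _) _; apply: heq_trans (heq_castr _ _) _.
  exact: heq_trans (heq_wr_wr _ _ _) (heq_sym (heq_cup _ _)).
by rewrite fE -compA -cup_natural compA -wl_comp s wl1 id_comp.
Qed.

Lemma bend_left a abar (r : hom tunit (abar \ox a))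
    (rbar : hom tunit (a \ox abar)) b (u : hom tunit (abar \ox b)) :
  snake rbar r ->
  exists f : hom a b, forall X, cup u X = wl abar (wr f X) \@ cup r X.
Proof.
move=> s; pose f := lunit b \@ wr rbar^\dag b \@ assocV a abar b \@ wl a u \@
  runitV a; exists f => X.
have fE Y : wr f Y = (cup rbar (b \ox Y))^\dag \@ wl a (cup u Y).
  apply: heqE; rewrite !wr_comp /lunit /assocV /runitV !wr_eqm.
  apply: heq_trans (heq_castl _ _) _; apply: heq_comp.
    apply: heq_trans (heq_wr_wr _ _ _) _.
    by rewrite -wr_dag; apply: heq_sym (heq_dag (heq_cup _ _)).
  apply: heq_trans (heq_castl _ _) _; apply: heq_trans (heq_castr _ _) _.
  apply: heq_trans (heq_wl_wr _ _ _) _; apply: heq_wl => //.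
  exact: heq_sym (heq_cup _ _).
have /(congr1 (@adj _ _ _ _)) := s (b \ox X).
rewrite dag_comp dagK dag1 wl_dag => s'.
by rewrite fE wl_comp -compA cup_natural compA s' id_comp.
Qed.

(** Rotation of [t] around the loop that closes a partial trace. In an
    arbitrary choice of duals [t'] need not be [t]. *)
Lemma ptr_rotate c cbar (rc : hom tunit (cbar \ox c)) X Xbar
    (r : hom tunit (Xbar \ox X)) (rbar : hom tunit (X \ox Xbar))
    (t : hom c X) :
  snake r rbar -> snake rbar r ->
  exists t' : hom c X, forall Y Z (g : hom (X \ox Y) (c \ox Z)),
    ptr rc (g \@ wr t Y) = ptr r (wr t' Z \@ g).
Proof.
move=> s s'.
(* [p] is the transpose of [t] with respect to the cups, and [q^\dag] is the
   transpose of [p] with respect to their adjoints. *)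
have [p pE] := bend_right (wl cbar t \@ rc) s.
have [q qE] := bend_left (wr p^\dag c \@ rc) s'.
exists q^\dag => Y Z g.
rewrite /ptr wl_comp -!compA -cup_wl pE [wl cbar g \@ _]compA -wl_wr -compA.
have -> : wr p (c \ox Z) = (wr p^\dag (c \ox Z))^\dag by rewrite wr_dag dagK.
rewrite compA -dag_comp -cup_wr qE dag_comp wl_dag wr_dag.
by rewrite wl_comp -!compA.
Qed.

(** The twist [ptr r (br X X Y)] is natural in [X] up to this rotation. *)
Lemma twist_rotate c cbar (rc : hom tunit (cbar \ox c)) X Xbar
    (r : hom tunit (Xbar \ox X)) (t t' : hom c X) Y :
  (forall Y Z (g : hom (X \ox Y) (c \ox Z)),
    ptr rc (g \@ wr t Y) = ptr r (wr t' Z \@ g)) ->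
  wr t Y \@ ptr rc (br c c Y) = ptr r (br X X Y) \@ wr t' Y.
Proof.
move=> h; rewrite -ptr_wll -br_natural_under h -br_natural_over.
exact: ptr_wlr.
Qed.

(** ** Duals of tensor products *)

(** The cup for [b \ox a], made of a cup for [b] inside a cup for [a]. *)
Definition cup_tens a abar b bbar (ra : hom tunit (abar \ox a))
    (rb : hom tunit (bbar \ox b)) :
    hom tunit ((abar \ox bbar) \ox (b \ox a)) :=
  assocV abar bbar (b \ox a) \@ wl abar (cup rb a) \@ ra.

Lemma heq_cup_tens a abar b bbar (ra : hom tunit (abar \ox a))
    (rb : hom tunit (bbar \ox b)) X :
  heq (cup (cup_tens ra rb) X) (wl abar (cup rb (a \ox X)) \@ cup ra X).
Proof.
apply: heq_trans (heq_cup _ _) _; rewrite /cup_tens !wr_comp /assocV wr_eqm.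
apply: heq_trans (heq_castl _ _) _; apply: heq_comp; last first.
  exact: heq_sym (heq_cup _ _).
apply: heq_trans (heq_wl_wr _ _ _) _; apply: heq_wl => //.
apply: heq_trans (heq_wr erefl (heq_cup _ _)) _.
exact: heq_trans (heq_wr_wr _ _ _) (heq_sym (heq_cup _ _)).
Qed.

Lemma cup_natural_dag a abar (r : hom tunit (abar \ox a)) X Y (f : hom X Y) :
  (cup r Y)^\dag \@ wl abar (wl a f) = f \@ (cup r X)^\dag.
Proof.
by apply: dag_inj; rewrite !dag_comp !dagK !wl_dag cup_natural.
Qed.

Lemma snake_tens a abar b bbar (ra : hom tunit (abar \ox a))
    (rabar : hom tunit (a \ox abar)) (rb : hom tunit (bbar \ox b))
    (rbbar : hom tunit (b \ox bbar)) :
  snake ra rabar -> snake rb rbbar ->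
  snake (cup_tens ra rb) (cup_tens rbbar rabar).
Proof.
move=> sa sb X; apply: heqE.
pose Z := b \ox (a \ox X).
apply: (heq_via (g :=
  ((wl b (cup rabar (bbar \ox Z)) \@ cup rbbar Z)^\dag \@
   wl b (wl a (wl abar (cup rb (a \ox X)) \@ cup ra X))))).
  apply: heq_comp.
    apply: heq_dag; apply: heq_trans (heq_cup_tens _ _ _) _.
    by rewrite /Z (tensA b a X); apply: heq_refl.
  apply: heq_trans (heq_wl_wl _ _ _) _.
  by do 2 apply: heq_wl => //; apply: heq_cup_tens.
rewrite dag_comp wl_dag -!compA -wl_comp [wl a (_ \@ _)]wl_comp.
rewrite [_ \@ (wl a _ \@ _)]compA cup_natural_dag -compA sa comp_id sb /Z.
by rewrite (tensA b a X); apply: heq_refl.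
Qed.

Lemma heq_ptr_tens a abar b bbar (ra : hom tunit (abar \ox a))
    (rb : hom tunit (bbar \ox b)) Y Z Y' Z'
    (f : hom ((b \ox a) \ox Y) ((b \ox a) \ox Z))
    (f' : hom (b \ox (a \ox Y')) (b \ox (a \ox Z'))) :
  Y = Y' -> Z = Z' -> heq f f' ->
  heq (ptr (cup_tens ra rb) f) (ptr ra (ptr rb f')).
Proof.
move=> eY eZ; case: Y' / eY f' => f'; case: Z' / eZ f' => f' hf.
rewrite /ptr !wl_comp.
apply: (heq_via (g :=
  ((wl abar (cup rb (a \ox Z)) \@ cup ra Z)^\dag \@
    wl abar (wl bbar f') \@ (wl abar (cup rb (a \ox Y)) \@ cup ra Y)))).
  apply: heq_comp; first exact: heq_dag (heq_cup_tens _ _ _).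
  apply: heq_comp; last exact: heq_cup_tens.
  apply: heq_trans (heq_wl_wl _ _ _) _.
  by do 2 apply: heq_wl => //.
by rewrite dag_comp wl_dag -!compA; apply: heq_refl.
Qed.

(** The twist of a tensor product is the tensor product of the twists, composed
    with the double braiding. *)
Lemma heq_ptr_br_tens a abar b bbar (ra : hom tunit (abar \ox a))
    (rb : hom tunit (bbar \ox b)) wa wb Y :
  (forall X, ptr ra (br a a X) = wa *: one (a \ox X)) ->
  (forall X, ptr rb (br b b X) = wb *: one (b \ox X)) ->
  heq (ptr (cup_tens ra rb) (br (b \ox a) (b \ox a) Y))
      ((wa * wb) *: (br a b Y \@ br b a Y)).
Proof.
move=> ha hb; pose A := br b a (a \ox Y) \@ wl b (br a a Y).
pose F := wl b A \@ br b b (a \ox (a \ox Y)) \@ wl b (br a b (a \ox Y)).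
have hF : heq (br (b \ox a) (b \ox a) Y) F.
  apply: heq_trans (heq_br_tensr _ _ _ _) _; apply: heq_comp.
    by apply: heq_wl => //; apply: heq_br_tensl.
  exact: heq_br_tensl.
apply: heq_trans (heq_ptr_tens ra rb (tensA b a Y) (tensA b a Y) hF) _.
have -> : ptr ra (ptr rb F) = (wa * wb) *: (br a b Y \@ br b a Y).
  rewrite /F ptr_wll ptr_wlr hb compZl compZr id_comp ptrZ /A -compA -br_braid.
  by rewrite ptr_wll ptr_wlr ha compZl compZr id_comp scalerA mulrC.
exact: heq_refl.
Qed.

End Diagrams.

(** * Standard solutions, dimensions and phases *)

Section Duals.
Variables (R : realType) (C : umtc R).
Implicit Types a b c X Y Z : C.

Lemma irr_unit : irreducible (tunit : C).
Proof. exact: unit_irreducible (umtc_fusion C). Qed.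

Lemma wr_unit_inj a b (f g : hom a b) : wr f tunit = wr g tunit -> f = g.
Proof.
move=> h; apply: heqE; apply: heq_trans (heq_sym (heq_wr_unit f)) _.
by rewrite h; apply: heq_wr_unit.
Qed.

Lemma cup_wl_inj a abar (r : hom tunit (abar \ox a))
    (rbar : hom tunit (a \ox abar)) b X (f g : hom (a \ox X) b) :
  snake r rbar -> wl abar f \@ cup r X = wl abar g \@ cup r X -> f = g.
Proof.
move=> s h; rewrite -[f]comp_id -[g]comp_id -(s X) !compA -!cup_natural_dag.
by rewrite -!compA -!wl_comp h.
Qed.

Lemma cup_wr_inj a abar (r : hom tunit (abar \ox a))
    (rbar : hom tunit (a \ox abar)) b (f g : hom abar b) :
  snake rbar r ->
  (forall X, wr f (a \ox X) \@ cup r X = wr g (a \ox X) \@ cup r X) -> f = g.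
Proof.
move=> s h; apply: wr_unit_inj.
have /(congr1 (@adj _ _ _ _)) := s tunit.
rewrite dag_comp dagK dag1 wl_dag => s'.
rewrite -[LHS]comp_id -[RHS]comp_id -s' !compA !wl_wr -!compA.
by rewrite h.
Qed.

Lemma snake_neq0 a abar (r : hom tunit (abar \ox a))
    (rbar : hom tunit (a \ox abar)) : irreducible a -> snake r rbar -> r != 0.
Proof.
move=> ha s; apply: contraNneq (irr_neq0 ha) => r0; apply/eqP.
apply: wr_unit_inj; rewrite wr1 wr0; apply: (cup_wl_inj s).
by rewrite cupE r0 wr0 comp0m compm0 !compm0.
Qed.

(** The dual of an irreducible object has only scalar endomorphisms. *)
Lemma dual_end_scalar a abar (r : hom tunit (abar \ox a))
    (rbar : hom tunit (a \ox abar)) (f : hom abar abar) :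
  irreducible a -> snake r rbar -> snake rbar r -> exists z, f = z *: one abar.
Proof.
move=> ha s s'; have [g gE] := bend_left (wr f a \@ r) s'.
exists (scal g); apply: (cup_wr_inj s') => X.
by rewrite -cup_wr gE (scalE g ha) !wrZ wlZ !wr1 wl1 scal_id.
Qed.

Section TwoSolutions.
Variables (a abar : C) (r : hom tunit (abar \ox a)).
Variables (rbar : hom tunit (a \ox abar)).

(** Standard solutions are unique up to a unitary. *)
Lemma standard_unique abar' (r' : hom tunit (abar' \ox a))
    (rbar' : hom tunit (a \ox abar')) :
  irreducible a -> standard_solution r rbar -> standard_solution r' rbar' ->
  exists2 u : hom abar abar', unitary u & r' = wr u a \@ r.
Proof.
move=> ha [/conj_snake[s1 s2] e] [/conj_snake[s1' s2'] e'].
have [u uE] := bend_right r' s1; have [w wE] := bend_left rbar' s1.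
have ur : r' = wr u a \@ r by apply: cup_inj; rewrite uE cup_wr.
have wr' : rbar' = wl a w \@ rbar by apply: cup_inj; rewrite wE cup_wl.
have [z zE] := dual_end_scalar (w^\dag \@ u) ha s1 s2.
have [mu muE] := dual_end_scalar (u^\dag \@ u) ha s1 s2.
have [nu nuE] := dual_end_scalar (w^\dag \@ w) ha s1 s2.
have [mu' mu'E] := dual_end_scalar (u \@ u^\dag) ha s1' s2'.
(* [u] relates the cups [r] and [r'], and [w] the cups [rbar] and [rbar']; the
   snake identity gives [w^\dag \@ u = 1], and the equality of norms then forces
   [u] to be unitary. *)
have z1 : w^\dag \@ u = one abar.
  have := s1' tunit; rewrite wr' ur cup_wl cup_wr dag_comp wl_dag wr_dag.
  rewrite wl_comp -!compA [wl a _ \@ wl a _ \@ _]compA -wl_comp -wr_comp zE.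
  rewrite wrZ wr1 wlZ wl1 compZl id_comp compZr s1 -wr1 -wrZ => h.
  have := congr1 (@scal R C a) (wr_unit_inj h).
  by rewrite scal_id // scal1 // => ->; rewrite scale1r.
have d_gt0 : scal (r^\dag \@ r) != 0.
  by apply: contra_neq (snake_neq0 ha s1); apply: scal_dag_eq0 irr_unit.
have munu : mu = nu.
  move: e'; rewrite ur wr' !dag_comp wl_dag wr_dag -!compA.
  rewrite [wr _ _ \@ wr _ _ \@ _]compA [wl _ _ \@ wl _ _ \@ _]compA.
  rewrite -wr_comp -wl_comp muE nuE wrZ wlZ wr1 wl1 !compZl !compZr !id_comp.
  rewrite -e => /(congr1 (@scal R C tunit)); rewrite !scalZ.
  exact: mulIf.
have abar_neq0 : one abar != 0.
  apply: contraNneq (snake_neq0 ha s1) => h.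
  by rewrite -[r]id_comp -tens_one wrE h wr0 comp0m.
have mu0 : mu != 0.
  apply: contraNneq abar_neq0 => m0; move: muE.
  by rewrite m0 scale0r => /dag_self_eq0 u0; rewrite -z1 u0 compm0.
have mu'mu : mu' = mu.
  have : (mu' - mu) *: u = 0.
    apply/eqP; rewrite scalerBl subr_eq0; apply/eqP.
    rewrite -{1}[u]id_comp -[in RHS](comp_id u) -compZl -compZr -mu'E -muE.
    by rewrite compA.
  move/eqP; rewrite scaler_eq0 subr_eq0 => /orP[/eqP // | /eqP u0].
  by case/eqP: abar_neq0; rewrite -z1 u0 compm0.
have uw : u^\dag = mu *: w^\dag.
  by rewrite -[u^\dag]id_comp -z1 -compA mu'E mu'mu compZr comp_id.
have muR : mu^* = mu.
  have /(congr1 (@adj R C _ _)) := muE; rewrite dag_comp dagK muE dagZ dag1.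
  move/eqP; rewrite -subr_eq0 -scalerBl scaler_eq0 (negPf abar_neq0) orbF.
  by rewrite subr_eq0 => /eqP.
have mu1 : mu = 1.
  have h : u = mu *: w by rewrite -[u]dagK uw dagZ dagK muR.
  have := muE; rewrite uw compZl {1}h compZr scalerA nuE scalerA -munu.
  move/eqP; rewrite -subr_eq0 -scalerBl scaler_eq0 (negPf abar_neq0) orbF.
  rewrite -{4}[mu]mulr1 -!mulrA -mulrBr mulf_eq0 (negPf mu0) /= subr_eq0.
  rewrite -expr2 sqrf_eq1 => /orP[/eqP // | /eqP mN].
  have /(scal_dag_ge0 _) : irreducible tunit := irr_unit.
  move=> /(_ _ (wr u a \@ r)); rewrite dag_comp wr_dag -compA.
  rewrite [wr _ _ \@ wr _ _ \@ _]compA -wr_comp muE wrZ wr1 compZl id_comp.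
  rewrite compZr scalZ mN mulN1r oppr_ge0 => le0.
  by move: d_gt0; rewrite eq_le le0 scal_dag_ge0 //; apply: irr_unit.
exists u => //; split; first by rewrite muE mu1 scale1r.
by rewrite mu'E mu'mu mu1 scale1r.
Qed.

End TwoSolutions.

Lemma standard_exists a : irreducible a ->
  exists abar (r : hom tunit (abar \ox a)) (rbar : hom tunit (a \ox abar)),
    standard_solution r rbar.
Proof.
move=> ha; have [abar [r [rbar h]]] := conjugates (umtc_fusion C) a.
have [s1 s2] := conj_snake h.
have p_gt0 : 0 < scal (r^\dag \@ r).
  by apply: scal_dag_gt0 irr_unit (snake_neq0 ha s1).
have q_gt0 : 0 < scal (rbar^\dag \@ rbar).
  apply: scal_dag_gt0 irr_unit _; apply: contraNneq (irr_neq0 ha) => r0.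
  apply/eqP; apply: wr_unit_inj; rewrite wr1 wr0 -(s1 tunit) cupE r0.
  by rewrite wr0 comp0m compm0 dag0 comp0m.
set p := scal _ in p_gt0; set q := scal _ in q_gt0.
(* Rescaling [r] by [s] and [rbar] by [s^-1] keeps the conjugate equations; the
   norms become equal when [s ^+ 4 = q / p]. *)
pose s := sqrtC (sqrtC (q / p)).
have s_gt0 : 0 < s by rewrite !sqrtC_gt0 divr_gt0.
have sR : s^* = s by apply: geC0_conj; apply: ltW.
have sVR : (s^-1)^* = s^-1 by apply: geC0_conj; rewrite invr_ge0 ltW.
have s4 : s ^+ 2 * p = s ^- 2 * q.
  apply: (mulfI (x := s ^+ 2)); first by rewrite expf_neq0 // gt_eqF.
  rewrite [RHS]mulrA divff ?expf_neq0 ?gt_eqF // mul1r mulrA -expr2.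
  by rewrite !sqrtCK divfK // gt_eqF.
exists abar, (s *: r), (s^-1 *: rbar); split; last first.
  rewrite !dagZ !compZl !compZr !scalerA sVR sR.
  rewrite (scalE (r^\dag \@ r) irr_unit) (scalE (rbar^\dag \@ _) irr_unit).
  by rewrite !scalerA -/p -/q -!expr2 s4 exprVn.
case: h => h1 h2; split.
  rewrite -[RHS]h1 !wrE !wlE dagZ wrZ wlZ !(compZl, compZr) !scalerA sVR.
  by rewrite mulVf ?gt_eqF // scale1r.
rewrite -[RHS]h2 !wrE !wlE dagZ wrZ wlZ !(compZl, compZr) !scalerA sR.
by rewrite mulfV ?gt_eqF // scale1r.
Qed.

(** A pair of cups that satisfies both snake identities, on which the loops
    evaluate to [qdim a] and the twist to [phase a]. *)
Definition dual_pair a abar (r : hom tunit (abar \ox a))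
    (rbar : hom tunit (a \ox abar)) : Prop :=
  [/\ snake r rbar, snake rbar r, r^\dag \@ r = qdim a *: one tunit,
      rbar^\dag \@ rbar = qdim a *: one tunit
    & forall X, ptr r (br a a X) = phase a *: one (a \ox X)].

Lemma standard_dual_pair a abar (r : hom tunit (abar \ox a))
    (rbar : hom tunit (a \ox abar)) :
  irreducible a -> standard_solution r rbar -> dual_pair r rbar.
Proof.
move=> ha sr; have [/conj_snake[s1 s2] e] := sr.
have rE : r^\dag \@ r = qdim a *: one tunit.
  rewrite /qdim; set P := (X in xget _ X).
  have [] : P (xget 0 P).
    apply: xgetPex; exists (scal (r^\dag \@ r)), abar, r, rbar; split=> //.
    exact: scalE irr_unit.
  move=> abar' [r' [rbar' [sr' <-]]].
  have [u [u1 _] ->] := standard_unique ha sr sr'.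
  rewrite dag_comp wr_dag -compA [wr _ _ \@ wr _ _ \@ _]compA -wr_comp u1.
  by rewrite wr1 id_comp.
split=> //; first by rewrite -e.
move=> X; rewrite /phase; set P := (Q in xget _ Q).
have [] : P (xget 0 P).
  apply: xgetPex; exists (scal (lunit a \@ (r^\dag \oxm one a) \@
    assocV abar a a \@ (one abar \oxm braid a a) \@ assoc abar a a \@
    (r \oxm one a) \@ lunitV a)), abar, r, rbar.
  by split=> //; apply: scalE.
move=> abar' [r' [rbar' [sr' /ptr_br h]]].
have [u [u1 _] ur] := standard_unique ha sr sr'.
rewrite -h /ptr ur cup_wr dag_comp wr_dag -!compA.
rewrite [wl abar' _ \@ _]compA -wl_wr -compA.
by rewrite [wr _ _ \@ wr _ _ \@ _]compA -wr_comp u1 wr1 id_comp.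
Qed.

End Duals.

Arguments irr_unit {R C}.

(** * Double braiding and traciality *)

Section Monodromy.
Variables (R : realType) (C : umtc R).
Implicit Types a b c X Y Z : C.

Lemma dual_pair_exists a : irreducible a ->
  exists abar (r : hom tunit (abar \ox a)) (rbar : hom tunit (a \ox abar)),
    dual_pair r rbar.
Proof.
move=> ha; have [abar [r [rbar h]]] := standard_exists ha.
by exists abar, r, rbar; apply: standard_dual_pair.
Qed.

Lemma qdim_gt0 a : irreducible a -> 0 < qdim a.
Proof.
move=> ha; have [abar [r [rbar [s1 _ rE _ _]]]] := dual_pair_exists ha.
have := scal_dag_gt0 irr_unit (snake_neq0 ha s1).
by rewrite rE scal_id //; apply: irr_unit.
Qed.

Lemma phase_unit a : irreducible a -> phase a * (phase a)^* = 1.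
Proof.
move=> ha; have [abar [r [rbar [s1 s2 rE rbE wE]]]] := dual_pair_exists ha.
have [b1 b2] := braid_unitary (umtc_braiding C) a abar.
pose v := (braid a abar)^\dag \@ r.
(* The cup [r] followed by the inverse braiding is a multiple of [rbar]; the
   coefficient has norm 1 as both cups have the same norm, and it is equal to
   the twist. *)
have [g gE] := bend_right v s2.
have cv Y : cup v Y = (br a abar Y)^\dag \@ cup r Y.
  apply: heqE; apply: heq_trans (heq_cup _ _) _; rewrite wr_comp.
  apply: heq_comp; last exact: heq_sym (heq_cup _ _).
  by rewrite -wr_dag; apply: heq_sym (heq_dag (heq_br _ _ _)).
have vE : v = scal g *: rbar.
  apply: cup_inj; rewrite gE {1}(scalE g ha) wrZ wr1 compZl id_comp.
  by rewrite !cupE wrZ compZl compZr.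
have zz : scal g * (scal g)^* = 1.
  have : v^\dag \@ v = r^\dag \@ r.
    by rewrite /v dag_comp dagK -compA [braid _ _ \@ _ \@ _]compA b2 id_comp.
  rewrite vE dagZ compZl compZr scalerA rE rbE scalerA.
  move=> /(congr1 (@scal R C _)).
  rewrite !(scal_id _ irr_unit) mulrC => h.
  have d0 : qdim a != 0 by rewrite gt_eqF // qdim_gt0.
  by apply: (mulfI d0); rewrite mulr1 [scal g * _]mulrC.
suff -> : phase a = scal g by [].
have h : (ptr r (br a a tunit))^\dag = (scal g)^* *: one _.
  rewrite -ptr_dag /ptr -{2}(br_cup a r tunit).
  rewrite [wl abar _ \@ wl abar _ \@ _]compA -wl_comp.
  have [br1 _] := br_unitary a a tunit.
  rewrite br1 wl1 id_comp compA.
  have -> : (cup r (a \ox tunit))^\dag \@ br a abar (a \ox tunit)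
      = (cup v (a \ox tunit))^\dag by rewrite cv dag_comp dagK.
  have -> : cup v (a \ox tunit) = scal g *: cup rbar (a \ox tunit).
    by rewrite !cupE vE wrZ compZl compZr.
  by rewrite dagZ compZl s1.
have := congr1 (@adj _ _ _ _) h; rewrite dagK wE dagZ dag1 conjCK.
rewrite -!wr1 -!wrZ => /wr_unit_inj/(congr1 (@scal R C a)).
by rewrite !scal_id.
Qed.

Lemma phase_neq0 a : irreducible a -> phase a != 0.
Proof.
move=> /phase_unit h; apply: contra_eq_neq h => ->.
by rewrite mul0r eq_sym oner_neq0.
Qed.

Lemma phase_conj a : irreducible a -> (phase a)^* = (phase a)^-1.
Proof.
move=> ha; apply: (mulfI (phase_neq0 ha)).
by rewrite phase_unit // divff // phase_neq0.
Qed.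

Section Channel.
Variables (a b c : C).
Hypotheses (ha : irreducible a) (hb : irreducible b) (hc : irreducible c).
Variables (abar bbar : C) (ra : hom tunit (abar \ox a)).
Variables (rabar : hom tunit (a \ox abar)) (rb : hom tunit (bbar \ox b)).
Variables (rbbar : hom tunit (b \ox bbar)).
Hypotheses (da : dual_pair ra rabar) (db : dual_pair rb rbbar).

Let r := cup_tens ra rb.
Let X := b \ox a.
Let k := phase c / (phase a * phase b).

Let M := braid a b \@ braid b a.

Let M_unitary : M^\dag \@ M = one X /\ M \@ M^\dag = one X.
Proof.
have [h1 h2] := braid_unitary (umtc_braiding C) a b.
have [h3 h4] := braid_unitary (umtc_braiding C) b a.
rewrite /M !dag_comp; split; rewrite -!compA.
  by rewrite [_ \@ braid a b \@ _]compA h1 id_comp h3.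
by rewrite [braid b a \@ _ \@ _]compA h4 id_comp h2.
Qed.

Let k_unit : k * k^* = 1.
Proof.
have h : k^* = k^-1.
  by rewrite /k rmorphM fmorphV rmorphM /= !phase_conj // -!invfM.
by rewrite h divff // /k mulf_neq0 ?invr_eq0 ?mulf_neq0 ?phase_neq0.
Qed.

(** The double braiding and the traciality of the partial traces are obtained
    together: [P], the inverse double braiding up to a phase, rotates [t]
    around the loop of the trace. [P] preserves the inner product
    [s^\dag \@ t], and it is positive for the inner product given by the trace;
    hence it is the identity. *)
Let P (t : hom c X) : hom c X := k *: (M^\dag \@ t).

Let P_rotate (t : hom c X) cbar (rc : hom tunit (cbar \ox c))
    (rcbar : hom tunit (c \ox cbar)) : dual_pair rc rcbar ->
  forall Y Z (g : hom (X \ox Y) (c \ox Z)),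
    ptr rc (g \@ wr t Y) = ptr r (wr (P t) Z \@ g).
Proof.
case=> _ _ _ _ wc; case: da => sa sa' _ _ wa; case: db => sb sb' _ _ wb.
have [t' t'E] := ptr_rotate rc t (snake_tens sa sb) (snake_tens sb' sa').
have := twist_rotate tunit t'E; rewrite wc compZr comp_id => h.
have {}h : phase c *: t = (phase a * phase b) *: (M \@ t').
  apply: heqE; apply: (heq_via (g := wr (phase c *: t) tunit)).
    exact: heq_sym (heq_wr_unit _).
  rewrite wrZ h -compZl; apply: heq_comp; last exact: heq_wr_unit.
  apply: heq_trans (heq_ptr_br_tens tunit wa wb) _; apply: heqZ.
  by apply: heq_comp; apply: heq_trans (heq_br _ _ _) (heq_wr_unit _).
suff -> : P t = t' by [].
have [mm _] := M_unitary.
have pp : phase a * phase b != 0 by rewrite mulf_neq0 ?phase_neq0.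
rewrite /P /k mulrC -scalerA -compZr h compZr scalerA mulVf // scale1r.
by rewrite compA mm id_comp.
Qed.

Let P_isometry (s t : hom c X) : (P s)^\dag \@ P t = s^\dag \@ t.
Proof.
have [_ mm] := M_unitary.
rewrite /P dagZ compZl compZr scalerA mulrC k_unit scale1r dag_comp dagK.
by rewrite -compA [M \@ _ \@ _]compA mm id_comp.
Qed.

Let PB (s t : hom c X) : P (s - t) = P s - P t.
Proof. by rewrite /P compDr compNr scalerBr. Qed.

(** The inner product on [hom c X] given by the trace over [X]. *)
Let H (t s : hom c X) : R[i] := scal (ptr r (wr (t \@ s^\dag) tunit)).

Let H_P (t s : hom c X) : H (P t) s = qdim c * scal (s^\dag \@ t).
Proof.
have [cbar [rc [rcbar dc]]] := dual_pair_exists hc.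
rewrite /H wr_comp -(P_rotate t dc) -wr_comp {1}(scalE (s^\dag \@ t) hc).
case: dc => _ _ rE _ _.
by rewrite wrZ wr1 ptrZ (ptr1 _ rE) scalerA (scal_id _ irr_unit) mulrC.
Qed.

Let H_conj (t s : hom c X) : H s t = (H t s)^*.
Proof.
rewrite /H -scal_dag; last exact: irr_unit.
by rewrite -ptr_dag wr_dag dag_comp dagK.
Qed.

Let ptr_wr_dag (t : hom c X) :
  ptr r (wr (t \@ t^\dag) tunit)
  = (wl (abar \ox bbar) (wr t^\dag tunit) \@ cup r tunit)^\dag \@
    (wl (abar \ox bbar) (wr t^\dag tunit) \@ cup r tunit).
Proof.
by rewrite /ptr dag_comp wl_dag wr_dag dagK wr_comp wl_comp -!compA.
Qed.

Let H_ge0 (t : hom c X) : 0 <= H t t.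
Proof. by rewrite /H ptr_wr_dag; apply: scal_dag_ge0 irr_unit. Qed.

Let H_eq0 (t : hom c X) : H t t = 0 -> t = 0.
Proof.
rewrite /H ptr_wr_dag => /(scal_dag_eq0 irr_unit) h.
case: da => sa _ _ _ _; case: db => sb _ _ _ _.
have : wr t^\dag tunit = wr 0 tunit.
  by apply: (cup_wl_inj (snake_tens sa sb)); rewrite h wr0 wl0 comp0m.
by move/wr_unit_inj/(congr1 (@adj _ _ _ _)); rewrite dagK dag0.
Qed.

Let HB (t t' s : hom c X) : H (t - t') s = H t s - H t' s.
Proof.
rewrite /H compDl compNl wrD -scaleN1r wrZ ptrD ptrZ scalD scalZ.
by rewrite mulN1r.
Qed.

Let P_id (t : hom c X) : P t = t.
Proof.
have Psym u s : H (P u) s = H u (P s).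
  rewrite [RHS]H_conj !H_P rmorphM /= -scal_dag // dag_comp dagK.
  by rewrite geC0_conj // ltW // qdim_gt0.
have P3 u : P (P (P u)) = P u.
  apply/eqP; rewrite -subr_eq0; apply/eqP; apply: H_eq0.
  set w := _ - _; rewrite {1}/w HB Psym H_P P_isometry -H_P.
  by rewrite subrr.
have P0 u : P u = 0 -> u = 0.
  by move=> h; apply: dag_self_eq0; rewrite -P_isometry h compm0.
have P2 u : P (P u) = u.
  by apply/eqP; rewrite -subr_eq0; apply/eqP/P0; rewrite PB P3 subrr.
pose u := t - P t.
have Pu : P u = 0 - u by rewrite /u PB P2 sub0r opprB.
suff u0 : u = 0 by apply/esym/eqP; rewrite -subr_eq0 -/u u0.
have := H_P u u; rewrite Pu HB.
have -> : H 0 u = 0 by rewrite /H comp0m wr0 ptr0 scal0 //; apply: irr_unit.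
rewrite sub0r => h.
have : 0 <= - H u u.
  by rewrite h mulr_ge0 ?scal_dag_ge0 // ltW // qdim_gt0.
rewrite oppr_ge0 => le0; apply: H_eq0.
by apply/eqP; rewrite eq_le le0 H_ge0.
Qed.

Lemma double_braid_dual (t : hom c (b \ox a)) :
  braid a b \@ braid b a \@ t
  = (phase c / (phase a * phase b)) *: t.
Proof.
have [_ mm] := M_unitary.
by rewrite -{1}(P_id t) /P !compZr !compA -/M mm id_comp.
Qed.

Lemma ptr_rank_one (t s : hom c (b \ox a)) :
  ptr r (wr (t \@ s^\dag) tunit) = (qdim c * scal (s^\dag \@ t)) *: one tunit.
Proof. by rewrite -H_P P_id -scalE //; apply: irr_unit. Qed.

End Channel.

Lemma double_braid a b c (t : hom c (b \ox a)) :
  irreducible a -> irreducible b -> irreducible c ->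
  braid a b \@ braid b a \@ t = (phase c / (phase a * phase b)) *: t.
Proof.
move=> ha hb hc; have [abar [ra [rabar da]]] := dual_pair_exists ha.
have [bbar [rb [rbbar db]]] := dual_pair_exists hb.
exact: (double_braid_dual ha hb hc da db).
Qed.

End Monodromy.

(** * Semisimplicity and traces on Hom spaces *)

Section Projections.
Variables (R : realType) (C : umtc R) (b : C).

Lemma nonscalar_selfadjoint : one b != 0 -> ~ irreducible b ->
  exists f : hom b b, f^\dag = f /\ forall z, f <> z *: one b.
Proof.
move=> b0 nirr.
have [h hN] : exists h : hom b b, forall z, h <> z *: one b.
  apply: contra_notP nirr => /forallNP hN; rewrite /irreducible.
  have -> : fullv = <[one b]>%VS :> {vspace hom b b}.
    apply/eqP; rewrite eqEsubv subvf andbT; apply/subvP => f _.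
    have /existsNP[z /contrapT ->] := hN f.
    by rewrite memvZ // memv_line.
  by rewrite dim_vline b0.
have [|] := pselect (exists z, h + h^\dag = z *: one b); last first.
  move=> /forallNP hz; exists (h + h^\dag); split; last exact: hz.
  by rewrite dagD dagK addrC.
case=> z hz; exists ('i *: (h - h^\dag)); split.
  by rewrite dagZ conjCi dagD dagN dagK scaleNr -scalerN opprB.
move=> w hw; apply: (hN (2^-1 * (z - 'i * w))).
have e : h - h^\dag = (- 'i * w) *: one b.
  by rewrite -scalerA -hw scalerA mulNr -expr2 sqrCi opprK scale1r.
rewrite -scalerA scalerBl -hz -scaleNr -mulNr -e addrACA subrr addr0.
by rewrite -mulr2n -[h *+ 2]scaler_nat scalerA mulVf ?scale1r // pnatr_eq0.
Qed.

Section Spectral.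
Variable f : hom b b.

(** The powers of [f]. *)
Let pow i : hom b b := iter i (comp f) (one b).

(** The product of the factors [f - z], for [z] in [s]. *)
Let pr (s : seq R[i]) : hom b b :=
  foldr (fun z g => (f - z *: one b) \@ g) (one b) s.

(** The value of [p] at [f], for [p] of size at most [N]. *)
Let ev N (p : {poly R[i]}) : hom b b := \sum_(i < N) p`_i *: pow i.

Let evM N z (p : {poly R[i]}) : (size p <= N)%N ->
  ev N.+1 (('X - z%:P) * p) = (f - z *: one b) \@ ev N p.
Proof.
move=> sp; rewrite compDl compNl compZl id_comp mulrBl /ev.
under eq_bigr do rewrite coefB coefXM coefCM scalerBl.
rewrite sumrB big_ord_recl /= scale0r add0r; congr (_ - _).
  rewrite comp_sumr; apply: eq_bigr => i _.
  by rewrite compZr /= /pow /bump.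
rewrite big_ord_recr /= nth_default // mulr0 scale0r addr0 scaler_sumr.
by apply: eq_bigr => i _; rewrite scalerA.
Qed.

Let ev_prod (s : seq R[i]) :
  ev (size s).+1 (\prod_(z <- s) ('X - z%:P)) = pr s.
Proof.
elim: s => [|z s IHs].
  by rewrite big_nil /ev big_ord1 /= coef1 eqxx scale1r.
by rewrite big_cons evM ?size_prod_XsubC //= IHs.
Qed.

Let annihilated : exists s, pr s = 0.
Proof.
set m := \dim {: hom b b}.
pose t : m.+1.-tuple (hom b b) := [tuple pow i | i < m.+1].
have : ~~ free t.
  apply: contraTN isT => /eqP ft.
  have := dimvS (subvf <<t>>%VS); rewrite ft size_tuple.
  by rewrite ltnn.
move/negP; apply: contra_notP => /forallNP hs; apply/freeP => k hk.
pose p := \poly_(i < m.+1) k (inord i).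
have pE i : p`_(val i) = k i.
  by rewrite coef_poly ltn_ord inord_val.
have evp : ev m.+1 p = 0.
  rewrite -[RHS]hk /ev; apply: eq_bigr => i _.
  by rewrite pE (nth_map i) ?size_enum_ord // nth_ord_enum.
have [p0|p0] := eqVneq p 0; first by move=> i; rewrite -pE p0 coef0.
have [s ps] := closed_field_poly_normal p.
case: (hs s); rewrite -ev_prod.
have sz : (size s < m.+1)%N.
  have := size_poly m.+1 (fun i => k (inord i)); rewrite -/p ps.
  by rewrite size_scale ?lead_coef_eq0 // size_prod_XsubC.
have : ev m.+1 (\prod_(z <- s) ('X - z%:P)) = 0.
  have : lead_coef p *: ev m.+1 (\prod_(z <- s) ('X - z%:P)) = 0.
    rewrite -[RHS]evp {2}ps /ev scaler_sumr; apply: eq_bigr => i _.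
    by rewrite coefZ scalerA.
  by move/eqP; rewrite scaler_eq0 lead_coef_eq0 (negPf p0) => /eqP.
rewrite /ev (big_ord_widen m.+1
  (fun i => (\prod_(z <- s) ('X - z%:P))`_i *: pow i) sz) => h.
rewrite big_mkcond -[RHS]h; apply: eq_bigr => i _.
case: ltnP => // si; rewrite nth_default ?scale0r //.
by rewrite size_prod_XsubC.
Qed.

Let pr_commute (g : hom b b) s : f \@ g = g \@ f -> pr s \@ g = g \@ pr s.
Proof.
move=> fg; elim: s => [|z s IHs] /=; first by rewrite id_comp comp_id.
rewrite -compA IHs !compA; congr (_ \@ _).
by rewrite compDl compDr fg compNl compNr compZl compZr id_comp comp_id.
Qed.

Let pr_eigen (g : hom b b) z s : f \@ g = z *: g ->
  exists w, pr s \@ g = w *: g.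
Proof.
move=> fg; elim: s => [|v s [w IHs]] /=.
  by exists 1; rewrite id_comp scale1r.
exists (w * (z - v)); rewrite -compA IHs compZr compDl compNl compZl id_comp.
by rewrite fg -scalerBl scalerA.
Qed.

(** A nontrivial spectral projection of a self-adjoint endomorphism. *)
Lemma spectral_projection : one b != 0 -> f^\dag = f ->
  (forall z, f <> z *: one b) ->
  exists p : hom b b, [/\ p != 0, p != one b, p \@ p = p & p^\dag = p].
Proof.
move=> b0 fd fN; have [s0 s00] := annihilated.
(* The product [pr (z :: s)] of the factors [f - z'] vanishes but [pr s] does
   not; a multiple of [pr s] is then the projection. *)
have [z [s [prs zs]]] : exists z s, pr s <> 0 /\ pr (z :: s) = 0.
  elim: s0 s00 => [/eqP|z s IHs zs]; first by rewrite /= (negPf b0).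
  by have [/IHs//|ps] := pselect (pr s = 0); exists z, s.
set g := pr s in prs.
have fg : f \@ g = z *: g.
  apply/eqP; rewrite -subr_eq0 -[in X in _ - X](id_comp g) -compZl -compNl.
  by rewrite -compDl; apply/eqP.
have gf : f \@ g = g \@ f by rewrite /g pr_commute.
have gN : g \@ g^\dag = g^\dag \@ g.
  by apply: pr_commute; apply: dag_inj; rewrite !dag_comp dagK fd.
have [w gg] := pr_eigen s fg; rewrite -/g in gg.
have w0 : w != 0.
  apply: contra_notN prs => /eqP w0; rewrite w0 scale0r in gg.
  apply: dag_self_eq0; apply: dag_self_eq0.
  by rewrite dag_comp dagK -!compA [g \@ g^\dag \@ _]compA gN -compA gg !compm0.
pose e := w^-1 *: g.
have ee : e \@ e = e.
  by rewrite /e compZl compZr gg !scalerA divfK.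
have eN : e \@ e^\dag = e^\dag \@ e.
  by rewrite /e dagZ !compZl !compZr gN !scalerA mulrC.
have ed : e^\dag \@ e^\dag = e^\dag by rewrite -dag_comp ee.
have e_sa : e = e^\dag \@ e.
  apply/eqP; rewrite -subr_eq0; apply/eqP; apply: dag_self_eq0.
  set y := e - _; have ey : e^\dag \@ y = 0.
    by rewrite compDr compNr compA ed subrr.
  rewrite {1}/y dagD dagN dag_comp dagK compDl compNl ey -eN -compA ey.
  by rewrite compm0 subrr.
exists e; split=> //.
- by rewrite scaler_eq0 invr_eq0 (negPf w0); apply/eqP.
- apply/eqP => e1; apply: (fN z).
  by rewrite -[f]comp_id -e1 /e compZr fg !scalerA mulrC.
- by rewrite {1}e_sa dag_comp dagK -e_sa.
Qed.

End Spectral.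
End Projections.

Section Semisimple.
Variables (R : realType) (C : umtc R).
Implicit Types a b c X Y : C.

Lemma irr_subobject b : one b != 0 ->
  exists c (v : hom c b), irreducible c /\ isometry v.
Proof.
have [m] := ubnP (\dim {: hom b b}).
elim: m b => // m IHm b; rewrite ltnS => bm b0.
have [hb|nb] := pselect (irreducible b).
  by exists b, (one b); split; rewrite // /isometry dag1 id_comp.
have [f [fd fN]] := nonscalar_selfadjoint b0 nb.
have [p [p0 p1 pp pd]] := spectral_projection b0 fd fN.
have [b' [v [v1 v2]]] := subobjects (umtc_fusion C) p0 pp pd.
have b'0 : one b' != 0.
  by apply: contraNneq p0 => h; rewrite -v2 -[v]comp_id h compm0 comp0m.
suff /IHm/(_ b'0)[c [w [hc w1]]] : (\dim {: hom b' b'} < m)%N.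
  exists c, (v \@ w); split; rewrite // /isometry dag_comp -compA.
  by rewrite [v^\dag \@ v \@ w]compA v1 id_comp.
apply: leq_trans bm; rewrite ltnNge; apply: contraNN p1 => le.
pose F (g : hom b' b') := v \@ g \@ v^\dag.
have FL : linear F.
  by move=> z g h; rewrite /F compDl compDr compZl compZr.
pose HB := GRing.isLinear.Build _ _ _ _ F FL.
pose Fl : {linear _ -> _} := HB.pack F HB.
have FE g : linfun Fl g = v \@ g \@ v^\dag by rewrite lfunE.
have ker0 : lker (linfun Fl) == 0%VS.
  apply/lker0P => g h; rewrite !FE => gh.
  have : v^\dag \@ (v \@ g \@ v^\dag) \@ v = v^\dag \@ (v \@ h \@ v^\dag) \@ v.
    by rewrite gh.
  by rewrite -!compA v1 !comp_id !compA v1 !id_comp.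
have : one b \in limg (linfun Fl).
  suff -> : limg (linfun Fl) = fullv by apply: memvf.
  apply/eqP; rewrite eqEdim subvf /= limg_dim_eq //.
  by rewrite (eqP ker0) capv0.
case/memv_imgP => g _; rewrite FE => h1.
apply/eqP; rewrite -v2 -[LHS]comp_id h1 -!compA [v^\dag \@ v \@ _]compA v1.
by rewrite id_comp.
Qed.

Lemma schur a b (f : hom a b) : irreducible a -> irreducible b -> f != 0 ->
  unitarily_isomorphic a b.
Proof.
move=> ha hb f0; have p0 := scal_dag_gt0 ha f0.
have q0 : 0 < scal (f \@ f^\dag).
  have := scal_dag_gt0 (f := f^\dag) hb; rewrite dagK; apply.
  by apply: contraNneq f0 => h; rewrite -[f]dagK h dag0.
set p := scal _ in p0; set q := scal _ in q0.
have pq : p = q.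
  have : p *: f = q *: f.
    rewrite -[in LHS](comp_id f) -[in RHS](id_comp f) -compZr -compZl.
    by rewrite -(scalE (f^\dag \@ f) ha) -(scalE (f \@ f^\dag) hb) compA.
  move/eqP; rewrite -subr_eq0 -scalerBl scaler_eq0 (negPf f0) orbF subr_eq0.
  by move/eqP.
pose s := sqrtC p; have s0 : 0 < s by rewrite sqrtC_gt0.
have sR : (s^-1)^* = s^-1 by apply: geC0_conj; rewrite invr_ge0 ltW.
have ss : s^-1 * (s^-1 * p) = 1.
  by rewrite mulrA -expr2 exprVn sqrtCK mulVf // gt_eqF.
exists (s^-1 *: f); split; rewrite dagZ compZl compZr sR.
  by rewrite (scalE (f^\dag \@ f) ha) -/p !scalerA -mulrA ss scale1r.
by rewrite (scalE (f \@ f^\dag) hb) -/q -pq !scalerA -mulrA ss scale1r.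
Qed.

(** ** Orthonormal bases of isometries *)

(** Pairwise orthogonal isometries, for the inner product [s^\dag \@ t] with
    values in the scalars [hom c c] of an irreducible [c]. *)
Definition orthonormal c X m (t : m.-tuple (hom c X)) : Prop :=
  forall e f, (tnth t e)^\dag \@ tnth t f = (e == f)%:R *: one c.

Definition onb c X (t : (\dim {: hom c X}).-tuple (hom c X)) : Prop :=
  basis_of fullv t /\ orthonormal t.

Lemma orthonormal_free c X m (t : m.-tuple (hom c X)) : irreducible c ->
  orthonormal t -> free t.
Proof.
move=> hc ot; apply/freeP => k hk i.
have /(congr1 (fun f => scal ((tnth t i)^\dag \@ f))) := hk.
rewrite compm0 scal0 // comp_sumr scal_sum (bigD1 i) //= big1 => [|j ji].
  by rewrite addr0 compZr -tnth_nth ot eqxx scale1r scalZ scal1 // mulr1.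
by rewrite compZr -tnth_nth ot eq_sym (negPf ji) scale0r scaler0 scal0.
Qed.

Lemma orthonormal_exists c X m : irreducible c ->
  (m <= \dim {: hom c X})%N ->
  exists t : m.-tuple (hom c X), orthonormal t.
Proof.
move=> hc; elim: m => [_|m IHm lt]; first by exists [tuple] => -[].
have [t ot] := IHm (ltnW lt).
have : ~~ (fullv <= <<t>>)%VS.
  apply: contraTN lt => /dimvS h; rewrite -leqNgt; apply: leq_trans h _.
  by apply: leq_trans (dim_span _) _; rewrite size_tuple.
case/subvPn => v _ vt.
pose w := v - \sum_i scal ((tnth t i)^\dag \@ v) *: tnth t i.
have w0 : w != 0.
  apply: contraNneq vt => /eqP; rewrite subr_eq0 => /eqP ->.
  by rewrite memv_suml // => i _; rewrite memvZ // memv_span // mem_tnth.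
have tw i : (tnth t i)^\dag \@ w = 0.
  rewrite compDr compNr comp_sumr (bigD1 i) //= big1 => [|j ji].
    rewrite addr0 compZr ot eqxx scale1r -scalE // subrr //.
  by rewrite compZr ot eq_sym (negPf ji) scale0r scaler0.
have wt i : w^\dag \@ tnth t i = 0.
  by apply: dag_inj; rewrite dag_comp dagK tw dag0.
have p0 := scal_dag_gt0 hc w0; set p := scal _ in p0.
pose s := sqrtC p; have s0 : 0 < s by rewrite sqrtC_gt0.
have sR : (s^-1)^* = s^-1 by apply: geC0_conj; rewrite invr_ge0 ltW.
have ss : s^-1 * (s^-1 * p) = 1.
  by rewrite mulrA -expr2 exprVn sqrtCK mulVf // gt_eqF.
exists [tuple of s^-1 *: w :: t] => e f.
case: (unliftP ord0 e) => [i|] ->; case: (unliftP ord0 f) => [j|] ->.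
- by rewrite !tnthS ot (inj_eq lift_inj).
- by rewrite tnthS tnth0 compZr tw scaler0 eq_sym -[_ == _]/false scale0r.
- by rewrite tnthS tnth0 dagZ compZl wt scaler0 -[_ == _]/false scale0r.
rewrite tnth0 dagZ compZl compZr sR (scalE (w^\dag \@ w) hc) -/p !scalerA.
by rewrite -mulrA ss eqxx.
Qed.

Lemma onb_exists c X : irreducible c ->
  exists t : (\dim {: hom c X}).-tuple (hom c X), onb t.
Proof.
move=> hc; have [t ot] := orthonormal_exists hc (leqnn (\dim {: hom c X})).
exists t; split=> //; rewrite basisEfree orthonormal_free // subvf.
by rewrite size_tuple leqnn.
Qed.

(** A choice of orthonormal basis. *)
Definition hbasis c X : (\dim {: hom c X}).-tuple (hom c X) :=
  xget [tuple 0 | _ < \dim {: hom c X}] [set t | onb t]%classic.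

Lemma hbasisP c X : irreducible c -> onb (hbasis c X).
Proof.
move=> hc; have [t ht] := onb_exists X hc.
by apply: (@xgetPex _ _ [set t | onb t]%classic); exists t.
Qed.

Lemma onb_expand c X (t : (\dim {: hom c X}).-tuple (hom c X)) (s : hom c X) :
  irreducible c -> onb t ->
  s = \sum_e scal ((tnth t e)^\dag \@ s) *: tnth t e.
Proof.
move=> hc [tb ot]; have sE := coord_basis tb (memvf s).
rewrite {1}sE; apply: eq_bigr => e _; rewrite -tnth_nth; congr (_ *: _).
rewrite {2}sE comp_sumr scal_sum (bigD1 e) //= big1 => [|j je].
  by rewrite addr0 compZr -tnth_nth ot eqxx scale1r scalZ scal1 // mulr1.
by rewrite compZr -tnth_nth ot eq_sym (negPf je) scale0r scaler0 scal0.
Qed.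

(** ** Traces on Hom spaces *)

Lemma onb_trace_comm c X Y (f : hom X Y) (g : hom Y X)
    (t : (\dim {: hom c X}).-tuple (hom c X))
    (s : (\dim {: hom c Y}).-tuple (hom c Y)) :
  irreducible c -> onb t -> onb s ->
  \sum_e scal ((tnth t e)^\dag \@ (g \@ f) \@ tnth t e)
  = \sum_e scal ((tnth s e)^\dag \@ (f \@ g) \@ tnth s e).
Proof.
move=> hc ht hs.
transitivity (\sum_e \sum_i scal ((tnth t e)^\dag \@ g \@ tnth s i) *
    scal ((tnth s i)^\dag \@ f \@ tnth t e)).
  apply: eq_bigr => e _; rewrite -compA {1}(onb_expand (f \@ tnth t e) hc hs).
  rewrite !comp_sumr scal_sum; apply: eq_bigr => i _.
  by rewrite !compZr scalZ mulrC.
rewrite exchange_big /=; apply: eq_bigr => i _.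
rewrite -compA [in RHS](onb_expand (g \@ tnth s i) hc ht).
rewrite !comp_sumr scal_sum; apply: eq_bigr => e _.
by rewrite !compZr scalZ.
Qed.

(** The trace of [t |-> f \@ t] on [hom c X]. *)
Definition htr c X (f : hom X X) : R[i] :=
  \sum_e scal ((tnth (hbasis c X) e)^\dag \@ f \@ tnth (hbasis c X) e).

Lemma htrE c X (f : hom X X) (t : (\dim {: hom c X}).-tuple (hom c X)) :
  irreducible c -> onb t ->
  htr c f = \sum_e scal ((tnth t e)^\dag \@ f \@ tnth t e).
Proof.
move=> hc ht; have := onb_trace_comm f (one X) hc (hbasisP X hc) ht.
by rewrite id_comp comp_id.
Qed.

Lemma htrC c X Y (f : hom X Y) (g : hom Y X) : irreducible c ->
  htr c (g \@ f) = htr c (f \@ g).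
Proof.
by move=> hc; apply: onb_trace_comm => //; apply: hbasisP.
Qed.

Lemma htr_sum c X I (s : seq I) (P : pred I) (F : I -> hom X X) :
  htr c (\sum_(i <- s | P i) F i) = \sum_(i <- s | P i) htr c (F i).
Proof.
rewrite /htr exchange_big /=.
by apply: eq_bigr => e _; rewrite comp_suml comp_sumr scal_sum.
Qed.

Lemma htrZ c X z (f : hom X X) : htr c (z *: f) = z * htr c f.
Proof.
rewrite /htr mulr_sumr.
by apply: eq_bigr => e _; rewrite compZl compZr scalZ.
Qed.

(** An endomorphism that acts on [hom c X] as the scalar [z]. *)
Lemma htr_scalar c X z (f : hom X X) : irreducible c ->
  (forall t : hom c X, f \@ t = z *: t) ->
  htr c f = z * (\dim {: hom c X})%:R.
Proof.
move=> hc hf; rewrite /htr (eq_bigr (fun=> z)) => [|e _].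
  by rewrite sumr_const card_ord mulr_natr.
by rewrite hf compZr (hbasisP X hc).2 eqxx scale1r scal_id.
Qed.

Section Spectrum.
Variables (n : nat) (x : 'I_n.+1 -> C).
Hypothesis hx : is_spectrum x.

Lemma spec_irr i : irreducible (x i).
Proof. by case: hx. Qed.

Lemma spec_schur i j (f : hom (x i) (x j)) : i != j -> f = 0.
Proof.
case: hx => h1 h2 _ _ ij; apply/eqP; apply: contraNT ij => f0.
by apply/eqP; apply: h2; apply: schur f0; apply: h1.
Qed.

(** Every object is the orthogonal sum of the images of isometries from the
    representatives. *)
Lemma resolution X :
  one X = \sum_k \sum_e
    (tnth (hbasis (x k) X) e \@ (tnth (hbasis (x k) X) e)^\dag).
Proof.
pose t k := hbasis (x k) X; have ht k : onb (t k) := hbasisP X (spec_irr k).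
pose q := \sum_k \sum_e (tnth (t k) e \@ (tnth (t k) e)^\dag).
pose p := one X - q.
have qd : q^\dag = q.
  rewrite /q dag_sum; apply: eq_bigr => k _; rewrite dag_sum.
  by apply: eq_bigr => e _; rewrite dag_comp dagK.
have qt k e : q \@ tnth (t k) e = tnth (t k) e.
  rewrite /q comp_suml (bigD1 k) //= [X in _ + X]big1 => [|l lk].
    rewrite addr0 comp_suml (bigD1 e) //= big1 => [|f fe].
      by rewrite addr0 -compA (ht k).2 eqxx scale1r comp_id.
    by rewrite -compA (ht k).2 (negPf fe) scale0r compm0.
  rewrite comp_suml big1 // => f _; rewrite -compA.
  by rewrite (spec_schur ((tnth (t l) f)^\dag \@ _)) ?compm0 // eq_sym.
have qq : q \@ q = q.
  rewrite {2}/q comp_sumr; apply: eq_bigr => k _; rewrite comp_sumr.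
  by apply: eq_bigr => e _; rewrite compA qt.
have pp : p \@ p = p.
  by rewrite /p compDr comp_id compNr compDl id_comp compNl qq subrr subr0.
have pd : p^\dag = p by rewrite /p dagD dagN dag1 qd.
suff p0 : p = 0 by apply/eqP; rewrite -subr_eq0 -/(t _) -/q -/p p0.
apply/eqP; apply: contraPT isT => p0.
have [b [v [v1 v2]]] := subobjects (umtc_fusion C) p0 pp pd.
have b0 : one b != 0.
  by apply: contraNneq p0 => h; rewrite -v2 -[v]comp_id h compm0 comp0m.
have [c [w [hc w1]]] := irr_subobject b0.
case: (hx) => _ _ /(_ c hc)[k [u [u1 u2]]] _.
pose s := v \@ w \@ u^\dag.
have s1 : s^\dag \@ s = one (x k).
  rewrite /s !dag_comp dagK -!compA [v^\dag \@ v \@ _]compA v1 id_comp.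
  by rewrite [w^\dag \@ w \@ _]compA w1 id_comp.
have ps : p \@ s = s.
  by rewrite /s -v2 -!compA [v^\dag \@ v \@ _]compA v1 id_comp.
have s0 : s = 0.
  rewrite (onb_expand s (spec_irr k) (ht k)) big1 // => e _.
  rewrite -ps compA; have -> : (tnth (t k) e)^\dag \@ p = 0.
    apply: dag_inj; rewrite dag_comp dagK pd dag0 /p compDl id_comp compNl qt.
    exact: subrr.
  by rewrite comp0m scal0 ?scale0r //; apply: spec_irr.
have := irr_neq0 (spec_irr k); rewrite -s1 s0 compm0 eqxx //.
Qed.

End Spectrum.

End Semisimple.

(** * The trace equation for the braiding *)

Section CategoricalTrace.
Variables (R : realType) (C : umtc R) (n : nat) (x : 'I_n.+1 -> C).
Hypothesis hx : is_spectrum x.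
Implicit Types X Y Z : C.

Let irr i : irreducible (x i) := spec_irr hx i.

(** The categorical trace of an endomorphism, computed from its action on the
    spaces [hom (x k) X]. *)
Definition qtr X (f : hom X X) : R[i] := \sum_k qdim (x k) * htr (x k) f.

Lemma qtrC X Y (f : hom X Y) (g : hom Y X) : qtr (g \@ f) = qtr (f \@ g).
Proof. by apply: eq_bigr => k _; rewrite htrC. Qed.

Lemma qtr_sum X I (s : seq I) (P : pred I) (F : I -> hom X X) :
  qtr (\sum_(i <- s | P i) F i) = \sum_(i <- s | P i) qtr (F i).
Proof.
rewrite /qtr exchange_big /=; apply: eq_bigr => k _.
by rewrite htr_sum mulr_sumr.
Qed.

Lemma qtrZ X z (f : hom X X) : qtr (z *: f) = z * qtr f.
Proof.
by rewrite /qtr mulr_sumr; apply: eq_bigr => k _; rewrite htrZ // mulrCA.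
Qed.

Lemma qtr_heq X Y (f : hom X X) (g : hom Y Y) : heq f g -> qtr f = qtr g.
Proof.
case=> e [e' ->]; case: _ / e e' => e'.
by rewrite (Prop_irrelevance e' erefl) id_comp comp_id.
Qed.

Lemma dim_hom_spec i k : \dim {: hom (x k) (x i)} = (k == i).
Proof.
have [->|ki] := eqVneq; first exact: irr.
apply/eqP; rewrite dimv_eq0; apply/eqP/vspaceP => f.
by rewrite (spec_schur hx f ki) !mem0v.
Qed.

Lemma qtr_irr i (f : hom (x i) (x i)) : qtr f = qdim (x i) * scal f.
Proof.
have hf k : htr (x k) f = scal f * (k == i)%:R.
  rewrite -dim_hom_spec; apply: htr_scalar => // t.
  by rewrite {1}(scalE f (irr i)) compZl id_comp.
rewrite /qtr (bigD1 i) //= hf eqxx mulr1 big1 ?addr0 // => k ki.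
by rewrite hf (negPf ki) !mulr0.
Qed.

Lemma ptr_wr a abar (r : hom tunit (abar \ox a)) Y Z
    (f : hom (a \ox Y) (a \ox Y)) :
  ptr r (assoc a Y Z \@ wr f Z \@ assocV a Y Z) = wr (ptr r f) Z.
Proof.
apply: heqE; rewrite /ptr !wr_comp.
have h : heq (cup r (Y \ox Z)) (wr (cup r Y) Z).
  apply: heq_trans (heq_cup _ _) _.
  apply: heq_trans (heq_sym (heq_wr_wr _ _ _)) _.
  by apply: heq_wr => //; apply: heq_sym (heq_cup _ _).
apply: heq_comp; first by rewrite -wr_dag; apply: heq_dag.
apply: heq_comp h; apply: heq_trans (heq_sym (heq_wl_wr _ _ _)).
by apply: heq_wl => //; apply: heq_conj.
Qed.

Section PartialTraceOver.
Variables (j : 'I_n.+1) (jbar : C) (rj : hom tunit (jbar \ox x j)).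
Variable rjbar : hom tunit (x j \ox jbar).
Hypothesis dj : dual_pair rj rjbar.

Let qtr_ptr_irr i (f : hom (x j \ox x i) (x j \ox x i)) :
  qtr f = qtr (ptr rj f).
Proof.
have [ibar [ri [ribar di]]] := dual_pair_exists (irr i).
have h1 : ptr (cup_tens ri rj) (wr f tunit) = qtr f *: one tunit.
  have fE : f = \sum_k \sum_e (tnth (hbasis (x k) (x j \ox x i)) e \@
      (f^\dag \@ tnth (hbasis (x k) (x j \ox x i)) e)^\dag).
    rewrite -{1}[f]id_comp (resolution hx) comp_suml; apply: eq_bigr => k _.
    rewrite comp_suml; apply: eq_bigr => e _.
    by rewrite dag_comp dagK compA.
  rewrite {1}fE wr_sum ptr_sum /qtr scaler_suml; apply: eq_bigr => k _.
  rewrite wr_sum ptr_sum /htr mulr_sumr scaler_suml; apply: eq_bigr => e _.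
  rewrite (ptr_rank_one (irr i) (irr j) (irr k) di dj).
  by rewrite dag_comp dagK -compA.
have h2 : ptr (cup_tens ri rj) (wr f tunit)
    = (qdim (x i) * scal (ptr rj f)) *: one tunit.
  case: di => _ _ riE _ _; apply: heqE.
  apply: heq_trans (heq_ptr_tens ri rj erefl erefl (heq_sym (heq_conj
    (tensA (x j) (x i) tunit) (esym (tensA (x j) (x i) tunit)) _))) _.
  rewrite ptr_wr (scalE (ptr rj f) (irr i)) wrZ wr1 ptrZ (ptr1 _ riE) scalerA.
  by rewrite scal_id // mulrC; apply: heq_refl.
have := congr1 (@scal R C tunit) (etrans (esym h1) h2).
by rewrite !(scal_id _ irr_unit) qtr_irr.
Qed.

(** The categorical trace factors through partial traces. *)
Lemma qtr_ptr X (f : hom (x j \ox X) (x j \ox X)) : qtr f = qtr (ptr rj f).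
Proof.
rewrite -[f in LHS]comp_id -wl1 (resolution hx X) wl_sum comp_sumr qtr_sum.
rewrite -[ptr rj f]comp_id (resolution hx X) comp_sumr qtr_sum.
apply: eq_bigr => k _; rewrite wl_sum !comp_sumr !qtr_sum.
apply: eq_bigr => e _; set t := tnth _ e.
rewrite wl_comp compA qtrC qtr_ptr_irr ptr_wll ptr_wlr -qtrC.
by rewrite -compA.
Qed.

End PartialTraceOver.
(** ** The modular equation for the traces of the braiding *)

Let D i j l := phase (x l) / (phase (x i) * phase (x j)).

(** The double braiding of [x j] and [x i]; it acts on the channel [x l] as
    [D i j l]. *)
Let mono i j : hom (x j \ox x i) (x j \ox x i) :=
  braid (x i) (x j) \@ braid (x j) (x i).

Let monoE i j l (t : hom (x l) (x j \ox x i)) : mono i j \@ t = D i j l *: t.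
Proof. by rewrite /mono -compA double_braid. Qed.

Let matrixY_conj j k : (matrixY x j k)^* = qtr (mono k j).
Proof.
rewrite mxE rmorph_sum /qtr; apply: eq_bigr => l _.
rewrite (htr_scalar _ (monoE (l := l))) //.
rewrite !rmorphM fmorphV /= !phase_conj // conjC_nat.
rewrite (geC0_conj (ltW (qdim_gt0 (irr l)))) mulrC; congr (_ * _).
rewrite mulrC /fusion; congr (_ * _); rewrite /D invrK mulrC -invfM.
by rewrite [_ * phase (x j)]mulrC.
Qed.

Lemma braid_trace_equation i j :
  \sum_k (matrixY x j k)^* * htr (x k) (braid (x i) (x i))
  = phase (x i) * \sum_l qdim (x l) * (D i j l ^+ 2 * (fusion x j i l)%:R).
Proof.
set a := x i; set b := x j; pose X := a \ox a.
have [abar [ra [rabar da]]] := dual_pair_exists (irr i).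
have [bbar [rb [rbbar db]]] := dual_pair_exists (irr j).
pose N := braid X b \@ braid b X; pose W := ptr rb N.
(* [b] encircling the two strands acts on the channel [x k] by a scalar. *)
have WE k (t : hom (x k) X) : W \@ t = scal (ptr rb (mono k j)) *: t.
  have e : N \@ wl b t = wl b t \@ mono k j.
    rewrite /N /mono -compA -wlE (braid_natural (umtc_braiding C)) compA.
    rewrite (braid_natural (umtc_braiding C)) wlE -!compA //.
  rewrite /W -ptr_wlr e ptr_wll {1}(scalE (ptr rb (mono k j)) (irr k)).
  by rewrite compZr comp_id.
have -> : \sum_k (matrixY x j k)^* * htr (x k) (braid a a)
    = qtr (braid a a \@ W).
  apply: eq_bigr => k _; rewrite matrixY_conj (qtr_ptr db) qtr_irr -mulrA.
  congr (_ * _); rewrite /htr mulr_sumr; apply: eq_bigr => e _.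
  by rewrite -compA WE !compZr scalZ.
rewrite /W -ptr_wll -(qtr_ptr db).
pose E := br a b tunit \@ br b a tunit.
pose F := wl b (br a a tunit) \@ br a b (a \ox tunit) \@
  wl a E \@ br b a (a \ox tunit).
have hF : heq (wl b (braid a a) \@ N) F.
  have br1 (c d : C) : heq (braid c d) (br c d tunit).
    by apply: heq_sym; apply: heq_trans (heq_br _ _ _) (heq_wr_unit _).
  rewrite /F /N /E wl_comp; apply: heq_comp.
    exact: heq_wl erefl (br1 _ _).
  rewrite -!compA compA; apply: heq_comp.
    by apply: heq_trans (br1 _ _) _; apply: heq_br_tensl.
  by apply: heq_trans (br1 _ _) _; apply: heq_br_tensr.
rewrite (qtr_heq hF).
have FE : F = (wl b (br a a tunit) \@ br a b (a \ox tunit) \@ wl a E) \@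
    br b a (a \ox tunit) by rewrite /F -!compA.
rewrite FE qtrC.
have -> : br b a (a \ox tunit) \@ (wl b (br a a tunit) \@
    br a b (a \ox tunit) \@ wl a E)
  = (wl a (br a b tunit) \@ br a a (b \ox tunit) \@ wl a (br b a tunit)) \@
    wl a E.
  by rewrite br_braid -!compA.
case: (da) => _ _ _ _ wa.
rewrite (qtr_ptr da) ptr_wlr ptr_wll ptr_wlr wa compZl id_comp compZr compZl.
rewrite qtrZ; congr (_ * _).
have hE : heq (br a b tunit \@ br b a tunit) (mono i j).
  by apply: heq_comp; apply: heq_trans (heq_br _ _ _) (heq_wr_unit _).
rewrite (qtr_heq (heq_comp hE hE)); apply: eq_bigr => l _; congr (_ * _).
rewrite (htr_scalar (z := D i j l ^+ 2)) // => t.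
by rewrite -compA !monoE scalerA.
Qed.

End CategoricalTrace.

(** * Eigenprojections and modular data *)

Section LinearAlgebra.

(** If [phi] squares to [l ^+ 2], its eigenprojection for [l] is
    [(phi + l) / (2 l)]. *)
Lemma eigenproj_involution (K : fieldType) (V : vectType K) (phi : 'End(V))
    (l : K) v : 2%:R != 0 :> K -> l != 0 ->
  (forall u, phi (phi u) = l ^+ 2 *: u) ->
  eigenproj phi l v = (2%:R * l)^-1 *: (phi v + l *: v).
Proof.
move=> c2 l0 phi2; rewrite /eigenproj.
set U := passmx.leigenspace phi l; set W := limg _.
have inU u : (u \in U) = (phi u == l *: u).
  by rewrite memv_ker !lfun_simp subr_eq0.
have d0 : 2%:R * l != 0 by rewrite mulf_neq0.
have UW : (U :&: W = 0)%VS.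
  apply/eqP; rewrite -subv0; apply/subvP => w; rewrite memv_cap inU memv0.
  case/andP => /eqP wU /memv_imgP[u _ wE].
  have : phi w = - l *: w.
    rewrite wE !lfun_simp linearB linearZ /= phi2 scalerBr !scaleNr opprK.
    by rewrite scalerA -expr2 addrC.
  rewrite wU => /eqP; rewrite -subr_eq0 -scalerBl opprK -mulr2n -mulr_natl.
  by rewrite scaler_eq0 (negPf d0).
set wp := _ *: _; pose wm := (2%:R * l)^-1 *: (l *: v - phi v).
have wpU : wp \in U.
  have h : phi (phi v + l *: v) = l *: (phi v + l *: v).
    by rewrite linearD linearZ /= phi2 scalerDr scalerA -expr2 addrC.
  by rewrite inU /wp linearZ /= h !scalerA [l * _]mulrC.
have wmW : wm \in W.
  rewrite memvZ // -[l *: v - phi v]opprB memvN.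
  have -> : phi v - l *: v = (phi - l *: \1%VF)%R v by rewrite !lfun_simp.
  exact: memv_img (memvf _).
have vE : v = wp + wm.
  rewrite /wp /wm -scalerDr [phi v + _]addrC addrACA subrr addr0 -mulr2n.
  by rewrite -[(l *: v) *+ 2]scaler_nat !scalerA mulVf // scale1r.
rewrite {1}vE linearD /= daddv_pi_id //.
have := daddv_pi_add UW (subvP (addvSr U W) _ wmW).
rewrite (@daddv_pi_id _ _ W U wm) // 1?capvC // => /eqP.
by rewrite -subr_eq0 addrK => /eqP->; rewrite addr0.
Qed.

Lemma idempotent_rank (K : fieldType) m (E : 'M[K]_m) :
  E *m E = E -> (\rank E)%:R = \tr E.
Proof.
move=> EE; have := EE; rewrite -{1 2 3}(mulmx_base E) -mulmxA.
move/(row_full_inj (col_base_full E)); rewrite mulmxA -[RHS]mul1mx.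
move/(row_free_inj (row_base_free E)) => h.
have -> : \tr E = \tr (row_base E *m col_base E).
  by rewrite mxtrace_mulC mulmx_base.
by rewrite h mxtrace1.
Qed.

End LinearAlgebra.

Section ModularInvariance.
Variable R : realType.

Section OneCategory.
Variables (C : umtc R) (n : nat) (x : 'I_n.+1 -> C).
Hypothesis hx : is_spectrum x.

Let irr i : irreducible (x i) := spec_irr hx i.

Lemma phase_ord0 : phase (x ord0) = 1.
Proof.
case: (hx) => _ _ _ [u [u1 u2]]; set a := x ord0 in u u1 u2 *.
have br1 : braid tunit tunit = one (tunit \ox tunit : C).
  apply: heqE; apply: heq_trans (heq_braid_unit _) _; apply: heq_sym.
  by rewrite -wl1; apply: heq_wl_unit.
have bra : braid a a = one (a \ox a).
  have := braid_natural (umtc_braiding C) u u; rewrite br1 id_comp.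
  move/(congr1 (fun f => (u \oxm u)^\dag \@ f)).
  by rewrite compA tens_dag tens_comp u1 tens_one id_comp.
pose t : hom a (a \ox a) := (u^\dag \oxm u^\dag) \@ lunitV tunit \@ u.
have t1 : t^\dag \@ t = one a.
  have [c1 c2] := eqm_unitary (esym (tens1o (tunit : C))).
  rewrite /t !dag_comp tens_dag !dagK -!compA.
  rewrite [(u \oxm u) \@ _ \@ _]compA tens_comp u2 tens_one id_comp.
  by rewrite [_ \@ lunitV _ \@ u]compA c1 id_comp u1.
have := double_braid t (irr ord0) (irr ord0) (irr ord0).
rewrite bra !id_comp -/a => /(congr1 (fun f => scal (t^\dag \@ f))).
rewrite compZr t1 scalZ scal1 ?mulr1; last exact: irr.
rewrite invfM mulVKf ?phase_neq0 //; last exact: irr.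
by move=> h; rewrite -[phase a]invrK -h invr1.
Qed.

Lemma fusion_ord0 i k : fusion x ord0 i k = (k == i).
Proof.
case: (hx) => _ _ _ [u [u1 u2]]; rewrite -(dim_hom_spec hx i k).
pose v : hom (x ord0 \ox x i) (x i) := lunit (x i) \@ wr u (x i).
have [c1 c2] := eqm_unitary (tens1o (x i)).
have v1 : v^\dag \@ v = one _.
  rewrite /v dag_comp wr_dag -compA [_ \@ lunit _ \@ _]compA c1 id_comp.
  by rewrite -wr_comp u1 wr1.
have v2 : v \@ v^\dag = one _.
  rewrite /v dag_comp wr_dag -compA [wr u _ \@ wr _ _ \@ _]compA -wr_comp.
  by rewrite u2 wr1 id_comp c2.
have h X : htr (x k) (one X) = (\dim {: hom (x k) X})%:R.
  rewrite -[RHS]mul1r; apply: htr_scalar => // t.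
  by rewrite id_comp scale1r.
apply/eqP; rewrite -(eqr_nat R[i]) /fusion -!h -v1 -v2.
by apply/eqP; apply: htrC.
Qed.

Lemma matrixY_ord0 i : matrixY x ord0 i = qdim (x i).
Proof.
rewrite mxE (bigD1 i) //= fusion_ord0 eqxx mul1r phase_ord0 mul1r.
rewrite divff ?mul1r ?phase_neq0 // big1 ?addr0 // => k ki.
by rewrite fusion_ord0 (negPf ki) !mul0r.
Qed.

Lemma sigma_neq0 : sigma x != 0.
Proof.
apply: contraTneq (umtc_modular hx) => s0.
by rewrite /matrixS s0 normr0 invr0 scale0r unitmxE det0 unitr0.
Qed.

Lemma matrixT_phase i : phase (x i) = matrixT x i i / matrixT x ord0 ord0.
Proof.
rewrite !mxE !eqxx !mulr1n phase_ord0 mulr1 mulrC mulKf //.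
by rewrite rootC_eq0 // mulf_neq0 ?invr_eq0 ?normr_eq0 ?sigma_neq0.
Qed.

Lemma matrixS_trace_equation i j :
  \sum_k (matrixS x j k)^* * htr (x k) (braid (x i) (x i))
  = phase (x i) * \sum_l matrixS x ord0 l *
      ((phase (x l) / (phase (x i) * phase (x j))) ^+ 2 * (fusion x j i l)%:R).
Proof.
pose s := `|sigma x|^-1.
have sR : s^* = s by apply: geC0_conj; rewrite invr_ge0.
transitivity (s * \sum_k (matrixY x j k)^* * htr (x k) (braid (x i) (x i))).
  rewrite mulr_sumr; apply: eq_bigr => k _.
  by rewrite mxE rmorphM /= -/s sR mulrA.
rewrite braid_trace_equation // mulrCA; congr (_ * _).
rewrite mulr_sumr; apply: eq_bigr => l _.
by rewrite [matrixS x ord0 l]mxE matrixY_ord0 /s -!mulrA.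
Qed.

End OneCategory.

(** The modular data determine the trace of the braiding of [x i] with itself on
    each space [hom (x k) (x i \ox x i)]. *)
Lemma same_modular_data_htr (C C' : umtc R) n (x : 'I_n.+1 -> C)
    (x' : 'I_n.+1 -> C') : is_spectrum x -> is_spectrum x' ->
  same_modular_data x x' ->
  forall i k, htr (x k) (braid (x i) (x i)) = htr (x' k) (braid (x' i) (x' i)).
Proof.
move=> hx hx' [hN hS hT] i k.
have ph l : phase (x l) = phase (x' l) by rewrite !matrixT_phase // hT.
pose v : 'cV[R[i]]_n.+1 := \col_k (htr (x k) (braid (x i) (x i))
  - htr (x' k) (braid (x' i) (x' i)))^*.
suff v0 : v = 0.
  apply/eqP; rewrite -subr_eq0 -conjC_eq0.
  by have /matrixP/(_ k ord0) := v0; rewrite !mxE => ->.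
rewrite -[v](mulKmx (umtc_modular hx)).
suff -> : matrixS x *m v = 0 by rewrite mulmx0.
apply/matrixP => j z; rewrite !mxE; apply: (inv_inj conjCK); rewrite rmorph0.
rewrite rmorph_sum /=.
under eq_bigr => l _ do rewrite [v _ _]mxE rmorphM /= conjCK mulrBr.
rewrite sumrB matrixS_trace_equation // {2}hS matrixS_trace_equation //.
rewrite hS ph.
by under eq_bigr => l _ do rewrite !ph hN; rewrite subrr.
Qed.

Lemma same_modular_data_phase (C C' : umtc R) n (x : 'I_n.+1 -> C)
    (x' : 'I_n.+1 -> C') : is_spectrum x -> is_spectrum x' ->
  same_modular_data x x' -> forall l, phase (x l) = phase (x' l).
Proof. by move=> hx hx' [_ _ hT] l; rewrite !matrixT_phase // hT. Qed.

End ModularInvariance.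

(** * Bases and R-matrices *)

Section Bases.
Variables (R : realType) (C : umtc R) (n : nat) (x : 'I_n.+1 -> C).
Hypothesis hx : is_spectrum x.
Variable root3 : 'I_n.+1 -> 'I_n.+1 -> 'I_n.+1 -> R[i].
Hypothesis hroot3 : forall i j k,
  root3 i j k ^+ 2 = phase (x k) / (phase (x i) * phase (x j)).
Hypothesis hroot3C : forall i j k, i != j -> root3 i j k = root3 j i k.

Let irr i : irreducible (x i) := spec_irr hx i.

Lemma phase_norm a : irreducible a -> `|phase (a : C)| = 1.
Proof.
move=> /phase_unit; rewrite -normCK => /eqP.
by rewrite pexpr_eq1 // => /eqP.
Qed.

Lemma sqrt_phase_conj i j k (z : R[i]) :
  z ^+ 2 = phase (x k) / (phase (x i) * phase (x j)) ->
  z != 0 /\ z^* = z^-1.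
Proof.
move=> hz; have z1 : `|z| = 1.
  have : `|z| ^+ 2 = 1.
    by rewrite -normrX hz normf_div normrM !phase_norm // mulr1 divr1.
  by move/eqP; rewrite pexpr_eq1 // => /eqP.
split; first by rewrite -normr_eq0 z1 oner_neq0.
by rewrite invC_norm z1 expr1n invr1 mul1r.
Qed.

(** For [j < i] the basis of [hom (x k) (x i \ox x j)] is the image under the
    braiding of that of [hom (x k) (x j \ox x i)], rescaled so that the
    braidings of [x i] with [x j] in both orders have the same matrix. *)
Definition braided_bases : hom_families x := fun i j k =>
  if (i <= j)%N then hbasis (x k) (x i \ox x j) else
  [tuple (root3 i j k)^-1 *: (braid (x j) (x i) \@
     tnth (hbasis (x k) (x j \ox x i)) (cast_ord (fusionC x i j k) e))
   | e < fusion x i j k].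

Lemma braided_basesE (i j k : 'I_n.+1) e : (j < i)%N ->
  tnth (braided_bases i j k) e = (root3 i j k)^-1 *: (braid (x j) (x i) \@
    tnth (braided_bases j i k) (cast_ord (fusionC x i j k) e)).
Proof.
move=> ji; rewrite /braided_bases leqNgt ji /= (ltnW ji).
by rewrite tnth_mktuple.
Qed.

Lemma braided_bases_orthonormal : orthonormal_bases braided_bases.
Proof.
move=> i j k; suff ot : orthonormal (braided_bases i j k).
  split=> //; rewrite basisEfree orthonormal_free // subvf.
  by rewrite size_tuple leqnn.
have [ij|ji] := leqP i j.
  rewrite /braided_bases ij; exact: (hbasisP _ (irr k)).2.
move=> e f; rewrite (braided_basesE e ji) (braided_basesE f ji).
rewrite /braided_bases (ltnW ji).
have [z0 zR] := sqrt_phase_conj (hroot3 i j k).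
rewrite dagZ dag_comp compZl compZr scalerA -!compA fmorphV /= zR invrK.
rewrite divff // scale1r.
have [b1 _] := braid_unitary (umtc_braiding C) (x j) (x i).
rewrite [(braid _ _)^\dag \@ _ \@ _]compA b1 id_comp.
by rewrite (hbasisP _ (irr k)).2 (inj_eq (@cast_ord_inj _ _ _)).
Qed.

Lemma Rmx_opE (t : hom_families x) i j k e f :
  Rmx_op t i j k e f = (Rmx t j i k (cast_ord (fusionC x i j k) f)
    (cast_ord (fusionC x i j k) e))^*.
Proof.
rewrite !mxE -scal_dag // !dag_comp dagK -!compA; congr (scal (_ \@ _ \@ _)).
by congr (tnth _ _); apply: val_inj.
Qed.

Lemma Rmx_lt (i j k : 'I_n.+1) : (i < j)%N ->
  Rmx braided_bases i j k = (root3 i j k)%:M /\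
  Rmx braided_bases j i k = (root3 i j k)%:M.
Proof.
move=> ij; have ne : j != i by rewrite neq_ltn ij orbT.
have [z0 zR] := sqrt_phase_conj (hroot3 i j k).
have [b1 _] := braid_unitary (umtc_braiding C) (x i) (x j).
have [_ ot] := braided_bases_orthonormal i j k.
split; apply/matrixP => e f; rewrite !mxE (braided_basesE _ ij) (hroot3C k ne).
  rewrite dagZ dag_comp !compZl fmorphV /= zR invrK -compA.
  rewrite [(braid _ _)^\dag \@ _ \@ _]compA b1 id_comp ot !scalZ.
  rewrite scal1 // mulr1 mulr_natr eq_sym; congr (_ *+ (_ == _)).
  exact: val_inj.
rewrite !compZr double_braid // compZr ot !scalZ scal1 // mulr1.
rewrite -hroot3 (hroot3C k ne) mulrA expr2 mulKf // mulr_natr.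
by rewrite eq_sym (inj_eq (@cast_ord_inj _ _ _)).
Qed.

Lemma Rmx_neq i j k : i != j -> Rmx braided_bases i j k = (root3 i j k)%:M.
Proof.
rewrite neq_ltn => /orP[ij|ji]; first by case: (Rmx_lt k ij).
have [_ ->] := Rmx_lt k ji; by rewrite hroot3C // neq_ltn ji.
Qed.

Lemma Rmx_op_neq i j k : i != j ->
  Rmx_op braided_bases i j k = ((root3 i j k)^-1)%:M.
Proof.
move=> ij; apply/matrixP => e f; rewrite Rmx_opE.
rewrite Rmx_neq; last by rewrite eq_sym.
have [z0 zR] := sqrt_phase_conj (hroot3 i j k).
rewrite -hroot3C // !mxE rmorphMn /= zR eq_sym.
by rewrite (inj_eq (@cast_ord_inj _ _ _)).
Qed.

End Bases.

Section Diagonal.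
Variables (R : realType) (C : umtc R) (n : nat) (x : 'I_n.+1 -> C).
Hypothesis hx : is_spectrum x.
Variables (t : hom_families x) (ot : orthonormal_bases t) (i k : 'I_n.+1).

Let irr l : irreducible (x l) := spec_irr hx l.
Let V := hom (x k) (x i \ox x i).
Let phi : 'End(V) := braid_end x i k.
Let Phi := end_mx t phi.

Let phiE v : phi v = braid (x i) (x i) \@ v.
Proof.
have fL : linear (fun v : V => braid (x i) (x i) \@ v).
  by move=> z u w; rewrite compDr compZr.
pose HB := GRing.isLinear.Build _ _ _ _ _ fL.
pose fl : {linear V -> V} := HB.pack (fun v : V => braid (x i) (x i) \@ v) HB.
exact: (lfunE fl v).
Qed.

Let end_mxE (P : 'End(V)) e :
  P (tnth (t i i k) e) = \sum_f end_mx t P e f *: tnth (t i i k) f.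
Proof.
rewrite {1}(onb_expand (P _) (irr k) (ot i i k)).
by apply: eq_bigr => f _; rewrite mxE.
Qed.

Let end_mx_comp (P Q : 'End(V)) :
  end_mx t (P \o Q)%VF = end_mx t Q *m end_mx t P.
Proof.
apply/matrixP => e f; rewrite mxE comp_lfunE end_mxE linear_sum comp_sumr.
rewrite scal_sum mxE; apply: eq_bigr => g _.
by rewrite linearZ /= compZr scalZ [end_mx t P g f]mxE.
Qed.

Let end_mx_scalar z : end_mx t (z *: \1%VF : 'End(V)) = z%:M.
Proof.
apply/matrixP => e f; rewrite !mxE !lfun_simp compZr (ot i i k).2 scalZ scalZ.
by rewrite scal1 // mulr1 mulr_natr eq_sym.
Qed.

Let end_mxD (P Q : 'End(V)) : end_mx t (P + Q) = end_mx t P + end_mx t Q.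
Proof. by apply/matrixP => e f; rewrite !mxE lfun_simp compDr scalD. Qed.

Let end_mxZ z (P : 'End(V)) : end_mx t (z *: P) = z *: end_mx t P.
Proof. by apply/matrixP => e f; rewrite !mxE lfun_simp compZr scalZ. Qed.

Lemma Rmx_diag : Rmx t i i k = Phi.
Proof.
apply/matrixP => e f; rewrite !mxE phiE; congr (scal (_ \@ _)).
by congr ((tnth _ _)^\dag); apply: val_inj.
Qed.

Lemma end_mx_trace : \tr Phi = htr (x k) (braid (x i) (x i)).
Proof.
rewrite (htrE _ (irr k) (ot i i k)); apply: eq_bigr => e _.
by rewrite mxE phiE.
Qed.

Section Eigenvalue.
Variable l : R[i].
Hypothesis hl : l ^+ 2 = phase (x k) / (phase (x i) * phase (x i)).

Let l_neq0 : l != 0. Proof. by case: (sqrt_phase_conj hx hl). Qed.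
Let l_conj : l^* = l^-1. Proof. by case: (sqrt_phase_conj hx hl). Qed.

Let phi2 v : phi (phi v) = l ^+ 2 *: v.
Proof. by rewrite !phiE hl double_braid. Qed.

Let two_neq0 : 2%:R != 0 :> R[i]. Proof. by rewrite pnatr_eq0. Qed.

Lemma end_mx_eigenproj :
  end_mx t (eigenproj phi l) = (2%:R * l)^-1 *: (Phi + l%:M).
Proof.
have -> : eigenproj phi l = (2%:R * l)^-1 *: (phi + l *: \1%VF).
  apply/lfunP => v; rewrite (eigenproj_involution v two_neq0 l_neq0 phi2).
  by rewrite !lfun_simp.
by rewrite end_mxZ end_mxD end_mx_scalar.
Qed.

Lemma Phi_sqr : Phi *m Phi = (l ^+ 2)%:M.
Proof.
rewrite -end_mx_comp -end_mx_scalar; congr (end_mx t _).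
by apply/lfunP => v; rewrite !lfun_simp /= phi2.
Qed.

Lemma Rmx_op_diag : Rmx_op t i i k = l ^- 2 *: Phi.
Proof.
have bE (v : V) : (braid (x i) (x i))^\dag \@ v
    = l ^- 2 *: (braid (x i) (x i) \@ v).
  have [b1 _] := braid_unitary (umtc_braiding C) (x i) (x i).
  have := phi2 v; rewrite !phiE.
  move=> /(congr1 (fun w => l ^- 2 *: ((braid (x i) (x i))^\dag \@ w))).
  by rewrite compA b1 id_comp compZr scalerA mulVf ?expf_neq0 // scale1r.
apply/matrixP => e f; rewrite !mxE phiE /braid_op bE compZr scalZ.
congr (_ * scal (_ \@ _)).
by congr ((tnth _ _)^\dag); apply: val_inj.
Qed.

Lemma Phi_adjoint : map_mx Num.conj Phi^T = l ^- 2 *: Phi.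
Proof.
rewrite -Rmx_op_diag; apply/matrixP => e f; rewrite Rmx_opE // Rmx_diag.
rewrite !mxE; congr (scal (_^\dag \@ _))^*.
  by congr (tnth _ _); apply: val_inj.
by congr (phi (tnth _ _)); apply: val_inj.
Qed.

Lemma eigenproj_idempotent :
  end_mx t (eigenproj phi l) *m end_mx t (eigenproj phi l)
  = end_mx t (eigenproj phi l).
Proof.
rewrite end_mx_eigenproj -scalemxAl -scalemxAr scalerA.
rewrite mulmxDl !mulmxDr Phi_sqr -scalar_mxM mul_mx_scalar mul_scalar_mx.
rewrite expr2 -!scale_scalar_mx -!scalerDr [l%:M + Phi]addrC -mulr2n.
rewrite -[(_ + _) *+ 2]scaler_nat !scalerA -!mulrA [l * _]mulrC mulrA.
by rewrite divfK // mulf_neq0.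
Qed.

Lemma eigenproj_orthogonal :
  orthogonal_projection (end_mx t (eigenproj phi l)).
Proof.
split; first exact: eigenproj_idempotent.
rewrite end_mx_eigenproj linearZ linearD /= tr_scalar_mx map_mxZ map_mxD /=.
rewrite map_scalar_mx /= Phi_adjoint fmorphV rmorphM /= conjC_nat l_conj.
have -> : (l^-1)%:M = l ^- 2 *: l%:M :> 'M[R[i]]_(fusion x i i k).
  by rewrite scale_scalar_mx expr2 invfM divfK.
rewrite -scalerDr scalerA; congr (_ *: _).
by rewrite !invfM invrK -!mulrA mulVKf.
Qed.

End Eigenvalue.

Lemma rank_eigenproj l : l ^+ 2 = phase (x k) / (phase (x i) * phase (x i)) ->
  (\rank (end_mx t (eigenproj phi l)))%:R
  = (2%:R * l)^-1 * (htr (x k) (braid (x i) (x i)) + l * (fusion x i i k)%:R)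
    :> R[i].
Proof.
move=> hl; rewrite idempotent_rank; last by apply: eigenproj_idempotent hl.
rewrite end_mx_eigenproj // linearZ linearD /= end_mx_trace mxtrace_scalar.
by rewrite mulr_natr.
Qed.

End Diagonal.

Theorem proposition3p2 (R : realType) (C : umtc R) (n : nat)
    (x : 'I_n.+1 -> C) (hx : is_spectrum x)
    (root3 : 'I_n.+1 -> 'I_n.+1 -> 'I_n.+1 -> R[i])
    (root1 : 'I_n.+1 -> R[i])
    (hroot3 : forall i j k,
      root3 i j k ^+ 2 = phase (x k) / (phase (x i) * phase (x j)))
    (hroot3C : forall i j k, i != j -> root3 i j k = root3 j i k)
    (hroot1 : forall k, root1 k ^+ 2 = phase (x k)) :
  exists t : hom_families x,
    [/\ orthonormal_bases t,
        forall i j k, i != j ->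
          [/\ Rmx t i j k = (root3 i j k)%:M,
              Rmx t j i k = (root3 i j k)%:M,
              Rmx_op t i j k = ((root3 i j k)^-1)%:M
            & Rmx_op t j i k = ((root3 i j k)^-1)%:M]
      & forall i k,
          let lambda := (phase (x i))^-1 * root1 k in
          let Ep := end_mx t (eigenproj (braid_end x i k) lambda) in
          let Em := end_mx t (eigenproj (braid_end x i k) (- lambda)) in
          [/\ Rmx t i i k = lambda *: (Ep - Em),
              Rmx_op t i i k = (phase (x i) * (root1 k)^-1) *: (Ep - Em),
              [/\ orthogonal_projection Ep, orthogonal_projection Em,
                  Ep *m Em = 0 & Ep + Em = 1%:M]
            & forall (C' : umtc R) (x' : 'I_n.+1 -> C') (t' : hom_families x'),
                is_spectrum x' -> same_modular_data x x' ->
                orthonormal_bases t' ->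
                let lambda' := (phase (x' i))^-1 * root1 k in
                \rank (end_mx t' (eigenproj (braid_end x' i k) lambda'))
                  = \rank Ep /\
                \rank (end_mx t' (eigenproj (braid_end x' i k) (- lambda')))
                  = \rank Em]].
Proof.
have ot := braided_bases_orthonormal hx hroot3.
exists (braided_bases x root3); split=> // [i j k ij|i k].
  have ji : j != i by rewrite eq_sym.
  rewrite !(Rmx_neq hx hroot3 hroot3C) // !(Rmx_op_neq hx hroot3 hroot3C) //.
  by rewrite (hroot3C j i k ji).
move=> lambda Ep Em.
have lE : lambda ^+ 2 = phase (x k) / (phase (x i) * phase (x i)).
  by rewrite exprMn hroot1 mulrC exprVn expr2.
have lNE : (- lambda) ^+ 2 = phase (x k) / (phase (x i) * phase (x i)).
  by rewrite sqrrN.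
have [l0 lc] := sqrt_phase_conj hx lE.
have two0 : 2%:R != 0 :> R[i] by rewrite pnatr_eq0.
pose Phi := end_mx (braided_bases x root3) (braid_end x i k).
have EpE : Ep = (2%:R * lambda)^-1 *: (Phi + lambda%:M).
  exact: (end_mx_eigenproj hx ot lE).
have EmE : Em = (2%:R * lambda)^-1 *: (lambda%:M - Phi).
  rewrite /Em (end_mx_eigenproj hx ot lNE) mulrN invrN scaleNr -scalerN.
  have -> : (- lambda)%:M = - lambda%:M :> 'M_(fusion x i i k).
    exact: raddfN.
  by rewrite opprB.
have PmE : Ep - Em = lambda^-1 *: Phi.
  rewrite EpE EmE -scalerBr opprB addrACA subrr addr0 -mulr2n.
  rewrite -[Phi *+ 2]scaler_nat scalerA invfM mulrAC mulVf // mul1r //.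
have PpE : Ep + Em = 1%:M.
  rewrite EpE EmE -scalerDr [Phi + _]addrC addrACA subrr addr0 -raddfD /=.
  by rewrite scale_scalar_mx -mulr2n -[lambda *+ 2]mulr_natl mulVf // mulf_neq0.
have EpO := eigenproj_orthogonal hx ot lE.
have EmO := eigenproj_orthogonal hx ot lNE.
split.
- by rewrite Rmx_diag PmE scalerA divff // scale1r.
- rewrite (Rmx_op_diag hx _ lE) PmE scalerA; congr (_ *: _).
  have -> : phase (x i) / root1 k = lambda^-1 by rewrite /lambda invfM invrK.
  by rewrite -invfM -expr2.
- split; [exact: EpO | exact: EmO | | exact: PpE].
  have -> : Em = 1%:M - Ep by rewrite -PpE addrAC subrr add0r.
  by rewrite mulmxBr mulmx1 (proj1 EpO) subrr.
move=> C' x' t' hx' same ot' lambda'.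
have ph := same_modular_data_phase hx hx' same.
have -> : lambda' = lambda by rewrite /lambda' -ph.
have lE' : lambda ^+ 2 = phase (x' k) / (phase (x' i) * phase (x' i)).
  by rewrite -!ph.
have lNE' : (- lambda) ^+ 2 = phase (x' k) / (phase (x' i) * phase (x' i)).
  by rewrite -!ph.
have hN : fusion x' i i k = fusion x i i k by case: same.
by split; apply/eqP; rewrite -(eqr_nat R[i]) !rank_eigenproj // hN
  (same_modular_data_htr hx hx' same).
Qed.
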